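(* Let $c>0$, $\omega>0$, and consider the spatial sections of the four-dimensional flat space-time with respect to a reference system rotating uniformly with angular velocity $\omega$ about the $z$-axis, i.e. the Riemannian metric $$dl^2 = dr^2+\frac{r^2}{1-\omega^2r^2/c^2}\,d\phi^2+dz^2,\qquad 0<r<c/\omega,\ \phi\in\mathbb{R},\ z\in\mathbb{R}.$$ The group of Lie point symmetries of its geodesic equations $$\ddot r-\frac{c^4 r}{(c^2-\omega^2r^2)^2}\dot\phi^2=0,\qquad \ddot\phi+\frac{2c^2}{r(c^2-\omega^2r^2)}\dot\phi\,\dot r=0,\qquad \ddot z=0$$ (dots denote $d/ds$) is a seven-dimensional Lie group which is neither nilpotent nor solvable. That is, the Lie algebra $\mathfrak{g}$ of infinitesimal point symmetries of this system has dimension $7$ and is neither nilpotent nor solvable. On the other hand, the variational symmetries among them form a five-dimensional subgroup which is solvable but not nilpotent. That is, the elements of $\mathfrak{g}$ which are variational symmetries of the arclength Lagrangian $$L=\sqrt{\dot r^2+\frac{c^2r^2}{c^2-\omega^2r^2}\dot\phi^2+\dot z^2}$$ form a five-dimensional Lie subalgebra of $\mathfrak{g}$ which is solvable but not nilpotent.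
   Context: The independent variable is $s$ (the arclength/affine parameter) and the dependent variables are $r,\phi,z$. An infinitesimal point transformation is a smooth vector field $$G=\Sigma\,\partial_s+R\,\partial_r+\Phi\,\partial_\phi+Z\,\partial_z$$ on $\{(s,r,\phi,z): s,\phi,z\in\mathbb{R},\ 0<r<c/\omega\}$, whose coefficients $\Sigma,R,\Phi,Z$ are functions of $(s,r,\phi,z)$. For a function $F$ of $(s,r,\phi,z)$, $\dot F$ and $\ddot F$ denote the first and second total derivatives with respect to $s$, e.g. $\dot F=F_s+\dot r F_r+\dot\phi F_\phi+\dot z F_z$. The first prolongation of $G$ is $$\mathrm{pr}^{(1)}G=G+(\dot R-\dot\Sigma\dot r)\partial_{\dot r}+(\dot\Phi-\dot\Sigma\dot\phi)\partial_{\dot\phi}+(\dot Z-\dot\Sigma\dot z)\partial_{\dot z},$$ and the second prolongation is $$\mathrm{pr}^{(2)}G=\mathrm{pr}^{(1)}G+(\ddot R-\ddot\Sigma\dot r-2\dot\Sigma\ddot r)\partial_{\ddot r}+(\ddot\Phi-\ddot\Sigma\dot\phi-2\dot\Sigma\ddot\phi)\partial_{\ddot\phi}+(\ddot Z-\ddot\Sigma\dot z-2\dot\Sigma\ddot z)\partial_{\ddot z}.$$ $G$ is an infinitesimal (Lie point) symmetry of the geodesic equations if $\mathrm{pr}^{(2)}G$ applied to the left-hand side of each of the three equations vanishes whenever the three equations hold. These vector fields form a Lie algebra under the Lie bracket of vector fields; properties of the symmetry group (dimension, solvability, nilpotency) are understood as properties of this Lie algebra. $G$ is a variational symmetry of $L$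 if it leaves the variational integral $\int L\,ds$ invariant, i.e. if $$\mathrm{pr}^{(1)}G(L)+L\,\dot\Sigma=0$$ identically in $(s,r,\phi,z,\dot r,\dot\phi,\dot z)$ with $(\dot r,\dot\phi,\dot z)\neq 0$. *)

(* Defs.v *)
From Stdlib Require Import Reals.
From Coquelicot Require Import Coquelicot.
Open Scope R_scope.

(** Functions of (s, r, phi, z), of (s, r, phi, z, r', phi', z') and of
    (s, r, phi, z, r', phi', z', r'', phi'', z''); in binders, [r1] and [r2]
    stand for r' and r'', and similarly for the other variables. *)
Definition fn0 := R -> R -> R -> R -> R.
Definition fn1 := R -> R -> R -> R -> R -> R -> R -> R.
Definition fn2 := R -> R -> R -> R -> R -> R -> R -> R -> R -> R -> R.

(** * Smooth vector fields on an open set of (s, r, phi, z)-space *)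

Definition d_s (F : fn0) : fn0 := fun s r phi z => Derive (fun t => F t r phi z) s.
Definition d_r (F : fn0) : fn0 := fun s r phi z => Derive (fun t => F s t phi z) r.
Definition d_phi (F : fn0) : fn0 := fun s r phi z => Derive (fun t => F s r t z) phi.
Definition d_z (F : fn0) : fn0 := fun s r phi z => Derive (fun t => F s r phi t) z.

Definition continuous_on (U : R -> R -> R -> R -> Prop) (F : fn0) : Prop :=
  forall s r phi z, U s r phi z ->
    continuous
      (fun p : R * R * R * R =>
         F (fst (fst (fst p))) (snd (fst (fst p))) (snd (fst p)) (snd p))
      (s, r, phi, z).

(* [Derive] is total, so the existence of the partial derivatives has to be
   required separately. *)
Fixpoint Ck (U : R -> R -> R -> R -> Prop) (k : nat) (F : fn0) : Prop :=
  continuous_on U F /\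
  match k with
  | O => True
  | S k' =>
      (forall s r phi z, U s r phi z ->
         ex_derive (fun t => F t r phi z) s /\
         ex_derive (fun t => F s t phi z) r /\
         ex_derive (fun t => F s r t z) phi /\
         ex_derive (fun t => F s r phi t) z) /\
      Ck U k' (d_s F) /\ Ck U k' (d_r F) /\ Ck U k' (d_phi F) /\ Ck U k' (d_z F)
  end.

Definition smooth_on (U : R -> R -> R -> R -> Prop) (F : fn0) : Prop :=
  forall k, Ck U k F.

(** The field  cs d/ds + cr d/dr + cphi d/dphi + cz d/dz.  *)
Record vfield := VField { cs : fn0; cr : fn0; cphi : fn0; cz : fn0 }.

Definition smooth_vfield (U : R -> R -> R -> R -> Prop) (G : vfield) : Prop :=
  smooth_on U (cs G) /\ smooth_on U (cr G) /\
  smooth_on U (cphi G) /\ smooth_on U (cz G).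

(* Coefficients are total functions, but only their restriction to U matters:
   equality of vector fields on U is [vf_eq U], and all the notions of linear
   algebra below are taken modulo it. *)
Definition vf_eq (U : R -> R -> R -> R -> Prop) (G H : vfield) : Prop :=
  forall s r phi z, U s r phi z ->
    cs G s r phi z = cs H s r phi z /\ cr G s r phi z = cr H s r phi z /\
    cphi G s r phi z = cphi H s r phi z /\ cz G s r phi z = cz H s r phi z.

Definition vf_zero : vfield :=
  VField (fun _ _ _ _ => 0) (fun _ _ _ _ => 0)
         (fun _ _ _ _ => 0) (fun _ _ _ _ => 0).

Definition vf_add (G H : vfield) : vfield :=
  VField (fun s r phi z => cs G s r phi z + cs H s r phi z)
         (fun s r phi z => cr G s r phi z + cr H s r phi z)
         (fun s r phi z => cphi G s r phi z + cphi H s r phi z)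
         (fun s r phi z => cz G s r phi z + cz H s r phi z).

Definition vf_scal (a : R) (G : vfield) : vfield :=
  VField (fun s r phi z => a * cs G s r phi z)
         (fun s r phi z => a * cr G s r phi z)
         (fun s r phi z => a * cphi G s r phi z)
         (fun s r phi z => a * cz G s r phi z).

Definition vf_app (G : vfield) (F : fn0) : fn0 := fun s r phi z =>
  cs G s r phi z * d_s F s r phi z + cr G s r phi z * d_r F s r phi z +
  cphi G s r phi z * d_phi F s r phi z + cz G s r phi z * d_z F s r phi z.

Definition lie_bracket (G H : vfield) : vfield :=
  VField
    (fun s r phi z => vf_app G (cs H) s r phi z - vf_app H (cs G) s r phi z)
    (fun s r phi z => vf_app G (cr H) s r phi z - vf_app H (cr G) s r phi z)
    (fun s r phi z => vf_app G (cphi H) s r phi z - vf_app H (cphi G) s r phi z)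
    (fun s r phi z => vf_app G (cz H) s r phi z - vf_app H (cz G) s r phi z).

(** * Lie algebras of vector fields *)

Definition is_lie_algebra (U : R -> R -> R -> R -> Prop) (g : vfield -> Prop)
  : Prop :=
  (forall G, g G -> smooth_vfield U G) /\
  (forall G H, vf_eq U G H -> g G -> g H) /\
  g vf_zero /\
  (forall G H, g G -> g H -> g (vf_add G H)) /\
  (forall a G, g G -> g (vf_scal a G)) /\
  (forall G H, g G -> g H -> g (lie_bracket G H)).

Fixpoint lincomb (n : nat) (a : nat -> R) (b : nat -> vfield) : vfield :=
  match n with
  | O => vf_zero
  | S m => vf_add (lincomb m a b) (vf_scal (a m) (b m))
  end.

Definition has_dim (U : R -> R -> R -> R -> Prop) (g : vfield -> Prop) (n : nat)
  : Prop :=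
  exists b : nat -> vfield,
    (forall i, (i < n)%nat -> g (b i)) /\
    (forall a, vf_eq U (lincomb n a b) vf_zero ->
       forall i, (i < n)%nat -> a i = 0) /\
    (forall G, g G -> exists a, vf_eq U G (lincomb n a b)).

Inductive bracket_span (U : R -> R -> R -> R -> Prop) (g h : vfield -> Prop)
  : vfield -> Prop :=
  | bs_bracket G H : g G -> h H -> bracket_span U g h (lie_bracket G H)
  | bs_zero : bracket_span U g h vf_zero
  | bs_add G H : bracket_span U g h G -> bracket_span U g h H ->
      bracket_span U g h (vf_add G H)
  | bs_scal a G : bracket_span U g h G -> bracket_span U g h (vf_scal a G)
  | bs_eq G H : vf_eq U G H -> bracket_span U g h G -> bracket_span U g h H.

Fixpoint derived_series (U : R -> R -> R -> R -> Prop) (g : vfield -> Prop)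
  (n : nat) : vfield -> Prop :=
  match n with
  | O => g
  | S m => bracket_span U (derived_series U g m) (derived_series U g m)
  end.

Fixpoint lower_central_series (U : R -> R -> R -> R -> Prop)
  (g : vfield -> Prop) (n : nat) : vfield -> Prop :=
  match n with
  | O => g
  | S m => bracket_span U g (lower_central_series U g m)
  end.

Definition solvable (U : R -> R -> R -> R -> Prop) (g : vfield -> Prop) : Prop :=
  exists n, forall G, derived_series U g n G -> vf_eq U G vf_zero.

Definition nilpotent (U : R -> R -> R -> R -> Prop) (g : vfield -> Prop) : Prop :=
  exists n, forall G, lower_central_series U g n G -> vf_eq U G vf_zero.

(** * Total derivatives and prolongations *)

Definition dot (F : fn0) : fn1 := fun s r phi z r1 phi1 z1 =>
  d_s F s r phi z + r1 * d_r F s r phi z +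
  phi1 * d_phi F s r phi z + z1 * d_z F s r phi z.

Definition total1 (F : fn1) : fn2 := fun s r phi z r1 phi1 z1 r2 phi2 z2 =>
  Derive (fun t => F t r phi z r1 phi1 z1) s +
  r1 * Derive (fun t => F s t phi z r1 phi1 z1) r +
  phi1 * Derive (fun t => F s r t z r1 phi1 z1) phi +
  z1 * Derive (fun t => F s r phi t r1 phi1 z1) z +
  r2 * Derive (fun t => F s r phi z t phi1 z1) r1 +
  phi2 * Derive (fun t => F s r phi z r1 t z1) phi1 +
  z2 * Derive (fun t => F s r phi z r1 phi1 t) z1.

Definition ddot (F : fn0) : fn2 := total1 (dot F).

Definition pr1 (G : vfield) (F : fn1) : fn1 := fun s r phi z r1 phi1 z1 =>
  let D C := dot C s r phi z r1 phi1 z1 in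
  cs G s r phi z * Derive (fun t => F t r phi z r1 phi1 z1) s +
  cr G s r phi z * Derive (fun t => F s t phi z r1 phi1 z1) r +
  cphi G s r phi z * Derive (fun t => F s r t z r1 phi1 z1) phi +
  cz G s r phi z * Derive (fun t => F s r phi t r1 phi1 z1) z +
  (D (cr G) - D (cs G) * r1) * Derive (fun t => F s r phi z t phi1 z1) r1 +
  (D (cphi G) - D (cs G) * phi1) * Derive (fun t => F s r phi z r1 t z1) phi1 +
  (D (cz G) - D (cs G) * z1) * Derive (fun t => F s r phi z r1 phi1 t) z1.

Definition pr2 (G : vfield) (F : fn2) : fn2 :=
  fun s r phi z r1 phi1 z1 r2 phi2 z2 =>
  let D C := dot C s r phi z r1 phi1 z1 in
  let DD C := ddot C s r phi z r1 phi1 z1 r2 phi2 z2 in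
  pr1 G (fun s' r' phi' z' r1' phi1' z1' =>
           F s' r' phi' z' r1' phi1' z1' r2 phi2 z2) s r phi z r1 phi1 z1 +
  (DD (cr G) - DD (cs G) * r1 - 2 * D (cs G) * r2) *
    Derive (fun t => F s r phi z r1 phi1 z1 t phi2 z2) r2 +
  (DD (cphi G) - DD (cs G) * phi1 - 2 * D (cs G) * phi2) *
    Derive (fun t => F s r phi z r1 phi1 z1 r2 t z2) phi2 +
  (DD (cz G) - DD (cs G) * z1 - 2 * D (cs G) * z2) *
    Derive (fun t => F s r phi z r1 phi1 z1 r2 phi2 t) z2.

(** * The rotating reference system *)

Definition dom (c w : R) : R -> R -> R -> R -> Prop :=
  fun s r phi z => 0 < r < c / w.

(** dl^2 at (r, phi, z), on the tangent vector (r1, phi1, z1) *)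
Definition metric (c w : R) (r phi z r1 phi1 z1 : R) : R :=
  r1 ^ 2 + r ^ 2 / (1 - w ^ 2 * r ^ 2 / c ^ 2) * phi1 ^ 2 + z1 ^ 2.

Definition energy (c w : R) : fn1 := fun s r phi z r1 phi1 z1 =>
  metric c w r phi z r1 phi1 z1 / 2.

(** Euler-Lagrange expressions of a first-order Lagrangian *)
Definition EL_r (L : fn1) : fn2 := fun s r phi z r1 phi1 z1 r2 phi2 z2 =>
  total1 (fun s r phi z r1 phi1 z1 =>
            Derive (fun t => L s r phi z t phi1 z1) r1)
    s r phi z r1 phi1 z1 r2 phi2 z2
  - Derive (fun t => L s t phi z r1 phi1 z1) r.
Definition EL_phi (L : fn1) : fn2 := fun s r phi z r1 phi1 z1 r2 phi2 z2 =>
  total1 (fun s r phi z r1 phi1 z1 =>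
            Derive (fun t => L s r phi z r1 t z1) phi1)
    s r phi z r1 phi1 z1 r2 phi2 z2
  - Derive (fun t => L s r t z r1 phi1 z1) phi.
Definition EL_z (L : fn1) : fn2 := fun s r phi z r1 phi1 z1 r2 phi2 z2 =>
  total1 (fun s r phi z r1 phi1 z1 =>
            Derive (fun t => L s r phi z r1 phi1 t) z1)
    s r phi z r1 phi1 z1 r2 phi2 z2
  - Derive (fun t => L s r phi t r1 phi1 z1) z.

(** The affinely parametrized geodesics of the metric are the extremals of its
    energy. *)
Definition metric_geodesic (c w s r phi z r1 phi1 z1 r2 phi2 z2 : R) : Prop :=
  EL_r (energy c w) s r phi z r1 phi1 z1 r2 phi2 z2 = 0 /\
  EL_phi (energy c w) s r phi z r1 phi1 z1 r2 phi2 z2 = 0 /\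
  EL_z (energy c w) s r phi z r1 phi1 z1 r2 phi2 z2 = 0.

Definition geo_r (c w : R) : fn2 := fun s r phi z r1 phi1 z1 r2 phi2 z2 =>
  r2 - c ^ 4 * r / (c ^ 2 - w ^ 2 * r ^ 2) ^ 2 * phi1 ^ 2.
Definition geo_phi (c w : R) : fn2 := fun s r phi z r1 phi1 z1 r2 phi2 z2 =>
  phi2 + 2 * c ^ 2 / (r * (c ^ 2 - w ^ 2 * r ^ 2)) * phi1 * r1.
Definition geo_z (c w : R) : fn2 := fun s r phi z r1 phi1 z1 r2 phi2 z2 => z2.

Definition geodesic_system (c w s r phi z r1 phi1 z1 r2 phi2 z2 : R) : Prop :=
  geo_r c w s r phi z r1 phi1 z1 r2 phi2 z2 = 0 /\
  geo_phi c w s r phi z r1 phi1 z1 r2 phi2 z2 = 0 /\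
  geo_z c w s r phi z r1 phi1 z1 r2 phi2 z2 = 0.

Definition point_symmetry (c w : R) (G : vfield) : Prop :=
  smooth_vfield (dom c w) G /\
  forall s r phi z r1 phi1 z1 r2 phi2 z2,
    dom c w s r phi z ->
    geodesic_system c w s r phi z r1 phi1 z1 r2 phi2 z2 ->
    pr2 G (geo_r c w) s r phi z r1 phi1 z1 r2 phi2 z2 = 0 /\
    pr2 G (geo_phi c w) s r phi z r1 phi1 z1 r2 phi2 z2 = 0 /\
    pr2 G (geo_z c w) s r phi z r1 phi1 z1 r2 phi2 z2 = 0.

Definition arclength (c w : R) : fn1 := fun s r phi z r1 phi1 z1 =>
  sqrt (r1 ^ 2 + c ^ 2 * r ^ 2 / (c ^ 2 - w ^ 2 * r ^ 2) * phi1 ^ 2 + z1 ^ 2).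

Definition variational_symmetry (c w : R) (L : fn1) (G : vfield) : Prop :=
  smooth_vfield (dom c w) G /\
  forall s r phi z r1 phi1 z1,
    dom c w s r phi z ->
    (r1, phi1, z1) <> (0, 0, 0) ->
    pr1 G L s r phi z r1 phi1 z1 +
    L s r phi z r1 phi1 z1 * dot (cs G) s r phi z r1 phi1 z1 = 0.

Definition variational_point_symmetry (c w : R) (G : vfield) : Prop :=
  point_symmetry c w G /\ variational_symmetry c w (arclength c w) G.

(* Main.v *)
Require Import Defs.
From Stdlib Require Import Reals Lra Lia FunctionalExtensionality.
From Coquelicot Require Import Coquelicot.
Open Scope R_scope.

(** On geodesics the prolonged equations are polynomials in the velocities, and
    their coefficients are the determining equations of G = (Sigma, R, Phi, Z).
    Those of Sigma and Z say that their covariant Hessians in (r, phi) vanish;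
    since the (r, phi)-surface is curved, Sigma and Z depend on s and z only.
    The derivatives of (R, Phi) in s and in z are then fields on the surface with
    covariant derivative a multiple of the identity, so curvature kills them too,
    which makes Sigma and Z affine in (s, z). Finally (R, Phi) is an affine field
    of the surface, hence preserves its Ricci tensor; as the curvature is not
    constant, R = 0 and Phi is constant. This leaves aff(2) + R, which contains
    the perfect algebra sl(2). For a field of this form the variation of the
    arclength is Z' z' / L, so the variational ones are those with Z constant. *)

(** * Calculus of smooth functions of (s, r, phi, z) *)

(** Along a geodesic z is affine in s, so s + k z is again an affine parameter; this is why the
    affine group of the (s, z)-plane acts on solutions. It accounts for six of the seven dimensions,
    the rotation d/dphi for the last. The work lies in excluding everything else. The determining
    equations are coupled through Sigma, and z'' = 0 is the equation that breaks the coupling: on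
    geodesics its prolongation involves Sigma and Z alone, and its cubic part is - z' times a
    quadratic form in the derivatives of Sigma. Curvature is used through the two factors A' - P A /
    2 and P' + P^2 / 2, which have no zeros: identities are cross-differentiated until a common
    higher derivative drops out and such a factor remains. In the variational condition Sigma
    cancels because the arclength is homogeneous of degree one in the velocities: d/ds, s d/ds and z
    d/ds merely reparametrize curves. Together with d/dphi and d/dz they give the five
    dimensions. *)

Definition agree (U : R -> R -> R -> R -> Prop) (F G : fn0) : Prop :=
  forall s r phi z, U s r phi z -> F s r phi z = G s r phi z.

Definition cst (k : R) : fn0 := fun _ _ _ _ => k.

(** Only [r] is constrained, so lines in the directions of s, phi and z stay in the domain.
    Derivatives in [r] are the ones that call for a local argument below. *)
Lemma dom_open c w s r phi z : dom c w s r phi z ->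
  exists d : posreal, forall s' r' phi' z', Rabs (r' - r) < d -> dom c w s' r' phi' z'.
Proof.
  unfold dom; intros H.
  assert (Hd : 0 < Rmin r (c / w - r)) by (apply Rmin_pos; lra).
  exists (mkposreal _ Hd); simpl; intros s' r' phi' z' Hr.
  apply Rabs_def2 in Hr.
  pose proof (Rmin_l r (c / w - r)); pose proof (Rmin_r r (c / w - r)); lra.
Qed.

Lemma agree_d_s c w F G : agree (dom c w) F G -> agree (dom c w) (d_s F) (d_s G).
Proof. intros E s r phi z H; apply Derive_ext; intros t; now apply E. Qed.

Lemma agree_d_phi c w F G : agree (dom c w) F G -> agree (dom c w) (d_phi F) (d_phi G).
Proof. intros E s r phi z H; apply Derive_ext; intros t; now apply E. Qed.

Lemma agree_d_z c w F G : agree (dom c w) F G -> agree (dom c w) (d_z F) (d_z G).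
Proof. intros E s r phi z H; apply Derive_ext; intros t; now apply E. Qed.

Lemma locally_dom_r c w s r phi z : dom c w s r phi z -> locally r (fun t => dom c w s t phi z).
Proof. intros H; destruct (dom_open _ _ _ _ _ _ H) as [d Hd]; exists d; intros t Ht; now apply Hd. Qed.

Lemma agree_d_r c w F G : agree (dom c w) F G -> agree (dom c w) (d_r F) (d_r G).
Proof.
  intros E s r phi z H; apply Derive_ext_loc.
  generalize (locally_dom_r _ _ _ _ _ _ H); apply (filter_imp (fun t => dom c w s t phi z)); intros t; apply E.
Qed.

Lemma agree_sym U F G : agree U F G -> agree U G F.
Proof. intros E s r phi z H; symmetry; now apply E. Qed.

Lemma ball_R4 (s r phi z s' r' phi' z' e : R) :
  ball ((s, r, phi, z) : R * R * R * R) e (s', r', phi', z') <->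
  Rabs (s' - s) < e /\ Rabs (r' - r) < e /\ Rabs (phi' - phi) < e /\ Rabs (z' - z) < e.
Proof.
  split.
  - intros [[[H1 H2] H3] H4]; auto.
  - intros (H1 & H2 & H3 & H4); repeat split; assumption.
Qed.

Lemma continuous_on_agree c w F G :
  agree (dom c w) F G -> Defs.continuous_on (dom c w) F -> Defs.continuous_on (dom c w) G.
Proof.
  intros E HF s r phi z H.
  apply continuous_ext_loc with (2 := HF s r phi z H).
  destruct (dom_open _ _ _ _ _ _ H) as [d Hd]; exists d.
  intros [[[s' r'] phi'] z'] Hb; simpl.
  apply ball_R4 in Hb; apply E, Hd, Hb.
Qed.

(** Vector fields are taken modulo [vf_eq], so smoothness has to pass between total functions that
    agree on the domain only. *)
Lemma Ck_agree c w k : forall F G,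
  agree (dom c w) F G -> Ck (dom c w) k F -> Ck (dom c w) k G.
Proof.
  induction k as [|k IH]; intros F G E [HF HF'].
  { split; [now apply continuous_on_agree with F | exact I]. }
  destruct HF' as (Hd & Hs & Hr & Hp & Hz).
  split; [now apply continuous_on_agree with F |].
  split; [| repeat split;
            [ eapply IH; [apply agree_d_s, E | exact Hs] | eapply IH; [apply agree_d_r, E | exact Hr]
            | eapply IH; [apply agree_d_phi, E | exact Hp] | eapply IH; [apply agree_d_z, E | exact Hz]]].
  intros s r phi z H; destruct (Hd _ _ _ _ H) as (H1 & H2 & H3 & H4).
  repeat split.
  - apply ex_derive_ext with (2 := H1); intros t; now apply E.
  - apply ex_derive_ext_loc with (2 := H2).
    generalize (locally_dom_r _ _ _ _ _ _ H); apply (filter_imp (fun t => dom c w s t phi z)); intros t; apply E.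
  - apply ex_derive_ext with (2 := H3); intros t; now apply E.
  - apply ex_derive_ext with (2 := H4); intros t; now apply E.
Qed.

Lemma smooth_on_agree c w F G :
  agree (dom c w) F G -> smooth_on (dom c w) F -> smooth_on (dom c w) G.
Proof. intros E HF k; now apply Ck_agree with F. Qed.

Lemma smooth_d_s U F : smooth_on U F -> smooth_on U (d_s F).
Proof. intros H k; destruct (H (S k)) as (_ & _ & H' & _); exact H'. Qed.

Lemma smooth_d_r U F : smooth_on U F -> smooth_on U (d_r F).
Proof. intros H k; destruct (H (S k)) as (_ & _ & _ & H' & _); exact H'. Qed.

Lemma smooth_d_phi U F : smooth_on U F -> smooth_on U (d_phi F).
Proof. intros H k; destruct (H (S k)) as (_ & _ & _ & _ & H' & _); exact H'. Qed.

Lemma smooth_d_z U F : smooth_on U F -> smooth_on U (d_z F).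
Proof. intros H k; destruct (H (S k)) as (_ & _ & _ & _ & _ & H'); exact H'. Qed.

Create HintDb smth.
#[local] Hint Resolve smooth_d_s smooth_d_r smooth_d_phi smooth_d_z : smth.

Lemma smooth_ex_derive U F s r phi z : smooth_on U F -> U s r phi z ->
  ex_derive (fun t => F t r phi z) s /\ ex_derive (fun t => F s t phi z) r /\
  ex_derive (fun t => F s r t z) phi /\ ex_derive (fun t => F s r phi t) z.
Proof. intros HF; destruct (HF 1%nat) as (_ & H & _); apply H. Qed.

Lemma is_derive_s U F s r phi z : smooth_on U F -> U s r phi z ->
  is_derive (fun t => F t r phi z) s (d_s F s r phi z).
Proof. intros HF H; apply Derive_correct, (smooth_ex_derive U F s r phi z HF H). Qed.

Lemma is_derive_r U F s r phi z : smooth_on U F -> U s r phi z ->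
  is_derive (fun t => F s t phi z) r (d_r F s r phi z).
Proof. intros HF H; apply Derive_correct, (smooth_ex_derive U F s r phi z HF H). Qed.

Lemma is_derive_phi U F s r phi z : smooth_on U F -> U s r phi z ->
  is_derive (fun t => F s r t z) phi (d_phi F s r phi z).
Proof. intros HF H; apply Derive_correct, (smooth_ex_derive U F s r phi z HF H). Qed.

Lemma is_derive_z U F s r phi z : smooth_on U F -> U s r phi z ->
  is_derive (fun t => F s r phi t) z (d_z F s r phi z).
Proof. intros HF H; apply Derive_correct, (smooth_ex_derive U F s r phi z HF H). Qed.

Lemma smooth_continuous U F s r phi z : smooth_on U F -> U s r phi z ->
  forall eps : posreal, exists d : posreal, forall s' r' phi' z',
    Rabs (s' - s) < d -> Rabs (r' - r) < d -> Rabs (phi' - phi) < d -> Rabs (z' - z) < d ->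
    Rabs (F s' r' phi' z' - F s r phi z) < eps.
Proof.
  intros HF H eps; destruct (HF 0%nat) as [Hc _].
  pose proof (proj1 (filterlim_locally _ _) (Hc s r phi z H) eps) as [d Hd].
  exists d; intros s' r' phi' z' H1 H2 H3 H4.
  apply (Hd (s', r', phi', z')), ball_R4; auto.
Qed.

Lemma Rabs_0_lt (x : R) (d : posreal) : Rabs (x - x) < d.
Proof. rewrite Rminus_diag, Rabs_R0; apply cond_pos. Qed.

Ltac schwarz_2d f x y K1 K2 Hc :=
  symmetry; apply (Schwarz f x y);
  [ | let e := fresh in let He := fresh in
    intros eps; destruct (Hc K1 ltac:(auto with smth) eps) as [e He];
    exists e; intros; apply He; auto using Rabs_0_lt
  | let e := fresh in let He := fresh in
    intros eps; destruct (Hc K2 ltac:(auto with smth) eps) as [e He];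
    exists e; intros; apply He; auto using Rabs_0_lt ].

(** Oriented for rewriting: on the right the derivatives stand in the order s, r, phi, z from the
    outside in, which serves as normal form of second derivatives. *)
Lemma smooth_schwarz c w F s r phi z : smooth_on (dom c w) F -> dom c w s r phi z ->
  d_r (d_s F) s r phi z = d_s (d_r F) s r phi z /\
  d_phi (d_s F) s r phi z = d_s (d_phi F) s r phi z /\
  d_z (d_s F) s r phi z = d_s (d_z F) s r phi z /\
  d_phi (d_r F) s r phi z = d_r (d_phi F) s r phi z /\
  d_z (d_r F) s r phi z = d_r (d_z F) s r phi z /\
  d_z (d_phi F) s r phi z = d_phi (d_z F) s r phi z.
Proof.
  intros HF H.
  destruct (dom_open _ _ _ _ _ _ H) as [d Hd].
  pose proof (fun K HK => smooth_continuous _ K s r phi z HK H) as Hc.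
  pose proof (smooth_d_s _ _ HF) as Hs; pose proof (smooth_d_r _ _ HF) as Hr.
  pose proof (smooth_d_phi _ _ HF) as Hp; pose proof (smooth_d_z _ _ HF) as Hz.
  pose proof (fun s' r' phi' z' D => smooth_ex_derive _ F s' r' phi' z' HF D) as X.
  pose proof (fun s' r' phi' z' D => smooth_ex_derive _ _ s' r' phi' z' Hs D) as Xs.
  pose proof (fun s' r' phi' z' D => smooth_ex_derive _ _ s' r' phi' z' Hr D) as Xr.
  pose proof (fun s' r' phi' z' D => smooth_ex_derive _ _ s' r' phi' z' Hp D) as Xp.
  pose proof (fun s' r' phi' z' D => smooth_ex_derive _ _ s' r' phi' z' Hz D) as Xz.
  pose proof (Rabs_0_lt r d) as Zr.
  split; [|split; [|split; [|split; [|split]]]].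
  - schwarz_2d (fun u v => F u v phi z) s r (d_s (d_r F)) (d_r (d_s F)) Hc.
    exists d; intros u v _ Hv; pose proof (Hd u v phi z Hv) as D.
    exact (conj (proj1 (X _ _ _ _ D)) (conj (proj1 (proj2 (X _ _ _ _ D)))
      (conj (proj1 (Xr _ _ _ _ D)) (proj1 (proj2 (Xs _ _ _ _ D)))))).
  - schwarz_2d (fun u v => F u r v z) s phi (d_s (d_phi F)) (d_phi (d_s F)) Hc.
    exists d; intros u v _ Hv; pose proof (Hd u r v z Zr) as D.
    exact (conj (proj1 (X _ _ _ _ D)) (conj (proj1 (proj2 (proj2 (X _ _ _ _ D))))
      (conj (proj1 (Xp _ _ _ _ D)) (proj1 (proj2 (proj2 (Xs _ _ _ _ D))))))).
  - schwarz_2d (fun u v => F u r phi v) s z (d_s (d_z F)) (d_z (d_s F)) Hc.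
    exists d; intros u v _ Hv; pose proof (Hd u r phi v Zr) as D.
    exact (conj (proj1 (X _ _ _ _ D)) (conj (proj2 (proj2 (proj2 (X _ _ _ _ D))))
      (conj (proj1 (Xz _ _ _ _ D)) (proj2 (proj2 (proj2 (Xs _ _ _ _ D))))))).
  - schwarz_2d (fun u v => F s u v z) r phi (d_r (d_phi F)) (d_phi (d_r F)) Hc.
    exists d; intros u v Hu _; pose proof (Hd s u v z Hu) as D.
    exact (conj (proj1 (proj2 (X _ _ _ _ D))) (conj (proj1 (proj2 (proj2 (X _ _ _ _ D))))
      (conj (proj1 (proj2 (Xp _ _ _ _ D))) (proj1 (proj2 (proj2 (Xr _ _ _ _ D))))))).
  - schwarz_2d (fun u v => F s u phi v) r z (d_r (d_z F)) (d_z (d_r F)) Hc.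
    exists d; intros u v Hu _; pose proof (Hd s u phi v Hu) as D.
    exact (conj (proj1 (proj2 (X _ _ _ _ D))) (conj (proj2 (proj2 (proj2 (X _ _ _ _ D))))
      (conj (proj1 (proj2 (Xz _ _ _ _ D))) (proj2 (proj2 (proj2 (Xr _ _ _ _ D))))))).
  - schwarz_2d (fun u v => F s r u v) phi z (d_phi (d_z F)) (d_z (d_phi F)) Hc.
    exists d; intros u v _ _; pose proof (Hd s r u v Zr) as D.
    exact (conj (proj1 (proj2 (proj2 (X _ _ _ _ D)))) (conj (proj2 (proj2 (proj2 (X _ _ _ _ D))))
      (conj (proj1 (proj2 (proj2 (Xz _ _ _ _ D)))) (proj2 (proj2 (proj2 (Xp _ _ _ _ D))))))).
Qed.

(** These rules are stated with the operations of R so that [derive_rules] can select them by the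
    shape of the function. *)
Lemma is_derive_Rplus (f g : R -> R) (x a b : R) :
  is_derive f x a -> is_derive g x b -> is_derive (fun t => f t + g t) x (a + b).
Proof. exact (is_derive_plus f g x a b). Qed.

Lemma is_derive_Rminus (f g : R -> R) (x a b : R) :
  is_derive f x a -> is_derive g x b -> is_derive (fun t => f t - g t) x (a - b).
Proof. exact (is_derive_minus f g x a b). Qed.

Lemma is_derive_Rmult (f g : R -> R) (x a b : R) :
  is_derive f x a -> is_derive g x b ->
  is_derive (fun t => f t * g t) x (a * g x + f x * b).
Proof. intros Hf Hg; exact (is_derive_mult f g x a b Hf Hg Rmult_comm). Qed.

Lemma is_derive_Rconst (k x : R) : is_derive (fun _ => k) x 0.
Proof. exact (is_derive_const k x). Qed.

Lemma is_derive_Rid (x : R) : is_derive (fun t => t) x 1.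
Proof. exact (is_derive_id x). Qed.

Lemma is_derive_value (f : R -> R) (x a b : R) : is_derive f x a -> a = b -> is_derive f x b.
Proof. now intros H <-. Qed.

Lemma Derive_value (f : R -> R) (x l : R) : is_derive f x l -> Derive f x = l.
Proof. apply is_derive_unique. Qed.

Ltac derive_rules :=
  lazymatch goal with
  | |- is_derive (fun _ => ?k) _ _ => apply is_derive_Rconst
  | |- is_derive (fun t => t) _ _ => apply is_derive_Rid
  | |- is_derive (Rmult ?k) ?x _ => apply (is_derive_Rmult (fun _ => k) (fun t => t)); derive_rules
  | |- is_derive (fun t => _ + _) _ _ => apply is_derive_Rplus; derive_rules
  | |- is_derive (fun t => _ - _) _ _ => apply is_derive_Rminus; derive_rules
  | |- is_derive (fun t => _ * _) _ _ => apply is_derive_Rmult; derive_rules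
  | U : dom ?c ?w ?s ?r ?phi ?z |- is_derive (fun t => ?F t ?r ?phi ?z) ?s _ =>
      apply (is_derive_s (dom c w) F); [auto with smth | exact U]
  | U : dom ?c ?w ?s ?r ?phi ?z |- is_derive (fun t => ?F ?s t ?phi ?z) ?r _ =>
      apply (is_derive_r (dom c w) F); [auto with smth | exact U]
  | U : dom ?c ?w ?s ?r ?phi ?z |- is_derive (fun t => ?F ?s ?r t ?z) ?phi _ =>
      apply (is_derive_phi (dom c w) F); [auto with smth | exact U]
  | U : dom ?c ?w ?s ?r ?phi ?z |- is_derive (?F ?s ?r ?phi) ?z _ =>
      apply (is_derive_z (dom c w) F); [auto with smth | exact U]
  | D : is_derive ?f ?x _ |- is_derive ?f ?x _ => exact D
  end.

Ltac derive := eapply is_derive_value; [derive_rules | cbv beta; try ring].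

(** * Prolongations of the geodesic equations *)

(** Merging mixed derivatives leaves one coefficient for each monomial in the velocities and
    accelerations, ready for comparison of coefficients. *)
Lemma ddot_smooth c w F s r phi z r1 phi1 z1 r2 phi2 z2 :
  smooth_on (dom c w) F -> dom c w s r phi z ->
  ddot F s r phi z r1 phi1 z1 r2 phi2 z2 =
  d_s (d_s F) s r phi z + 2 * r1 * d_s (d_r F) s r phi z
  + 2 * phi1 * d_s (d_phi F) s r phi z + 2 * z1 * d_s (d_z F) s r phi z
  + r1 ^ 2 * d_r (d_r F) s r phi z + phi1 ^ 2 * d_phi (d_phi F) s r phi z
  + z1 ^ 2 * d_z (d_z F) s r phi z + 2 * r1 * phi1 * d_r (d_phi F) s r phi z
  + 2 * r1 * z1 * d_r (d_z F) s r phi z + 2 * phi1 * z1 * d_phi (d_z F) s r phi z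
  + r2 * d_r F s r phi z + phi2 * d_phi F s r phi z + z2 * d_z F s r phi z.
Proof.
  intros HF H.
  destruct (smooth_schwarz c w F s r phi z HF H) as (E1 & E2 & E3 & E4 & E5 & E6).
  unfold ddot, total1.
  assert (Ds : Derive (fun t => dot F t r phi z r1 phi1 z1) s =
    (d_s (d_s F) s r phi z + r1 * d_s (d_r F) s r phi z +
     phi1 * d_s (d_phi F) s r phi z + z1 * d_s (d_z F) s r phi z))
    by (apply is_derive_unique; unfold dot; derive).
  assert (Dr : Derive (fun t => dot F s t phi z r1 phi1 z1) r =
    (d_r (d_s F) s r phi z + r1 * d_r (d_r F) s r phi z +
     phi1 * d_r (d_phi F) s r phi z + z1 * d_r (d_z F) s r phi z))
    by (apply is_derive_unique; unfold dot; derive).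
  assert (Dp : Derive (fun t => dot F s r t z r1 phi1 z1) phi =
    (d_phi (d_s F) s r phi z + r1 * d_phi (d_r F) s r phi z +
     phi1 * d_phi (d_phi F) s r phi z + z1 * d_phi (d_z F) s r phi z))
    by (apply is_derive_unique; unfold dot; derive).
  assert (Dz : Derive (fun t => dot F s r phi t r1 phi1 z1) z =
    (d_z (d_s F) s r phi z + r1 * d_z (d_r F) s r phi z +
     phi1 * d_z (d_phi F) s r phi z + z1 * d_z (d_z F) s r phi z))
    by (apply is_derive_unique; unfold dot; derive).
  assert (Dr1 : Derive (fun t => dot F s r phi z t phi1 z1) r1 =
    (d_r F s r phi z))
    by (apply is_derive_unique; unfold dot; derive).
  assert (Dp1 : Derive (fun t => dot F s r phi z r1 t z1) phi1 =
    (d_phi F s r phi z))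
    by (apply is_derive_unique; unfold dot; derive).
  assert (Dz1 : Derive (fun t => dot F s r phi z r1 phi1 t) z1 =
    (d_z F s r phi z))
    by (apply is_derive_unique; unfold dot; derive).
  rewrite Ds, Dr, Dp, Dz, Dr1, Dp1, Dz1, E1, E2, E3, E4, E5, E6; ring.
Qed.

(* The geodesics satisfy r'' = A phi'^2 and phi'' = - P phi' r'; [cdA], [cddA]
   and [cdP] are the derivatives A', A'' and P'. *)
Definition cA c w r := c ^ 4 * r / (c ^ 2 - w ^ 2 * r ^ 2) ^ 2.
Definition cdA c w r := c ^ 4 * (c ^ 2 + 3 * w ^ 2 * r ^ 2) / (c ^ 2 - w ^ 2 * r ^ 2) ^ 3.
Definition cddA c w r :=
  12 * c ^ 4 * w ^ 2 * r * (c ^ 2 + w ^ 2 * r ^ 2) / (c ^ 2 - w ^ 2 * r ^ 2) ^ 4.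
Definition cP c w r := 2 * c ^ 2 / (r * (c ^ 2 - w ^ 2 * r ^ 2)).
Definition cdP c w r :=
  - 2 * c ^ 2 * (c ^ 2 - 3 * w ^ 2 * r ^ 2) / (r ^ 2 * (c ^ 2 - w ^ 2 * r ^ 2) ^ 2).

Lemma dom_pos c w s r phi z : 0 < c -> 0 < w -> dom c w s r phi z ->
  0 < r /\ 0 < c ^ 2 - w ^ 2 * r ^ 2.
Proof.
  intros hc hw [H1 H2]; split; [exact H1 |].
  assert (w * r < c)
    by (apply (Rmult_lt_compat_l w) in H2; [field_simplify in H2; lra | lra]).
  assert (0 < w * r) by (apply Rmult_lt_0_compat; lra).
  nra.
Qed.

Lemma is_derive_cA c w r : 0 < c ^ 2 - w ^ 2 * r ^ 2 -> is_derive (cA c w) r (cdA c w r).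
Proof.
  intros H; unfold cA, cdA; auto_derive; [| field; lra].
  apply Rgt_not_eq, Rlt_gt; ring_simplify; nra.
Qed.

Lemma is_derive_cdA c w r : 0 < c ^ 2 - w ^ 2 * r ^ 2 -> is_derive (cdA c w) r (cddA c w r).
Proof.
  intros H; unfold cdA, cddA; auto_derive; [| field; lra].
  apply Rgt_not_eq; repeat apply Rmult_lt_0_compat; nra.
Qed.

Lemma is_derive_cP c w r : 0 < r -> 0 < c ^ 2 - w ^ 2 * r ^ 2 ->
  is_derive (cP c w) r (cdP c w r).
Proof.
  intros Hr H; unfold cP, cdP; auto_derive; [| field; lra].
  apply Rgt_not_eq; repeat apply Rmult_lt_0_compat; nra.
Qed.

Lemma pr2_geo_r c w G s r phi z r1 phi1 z1 r2 phi2 z2 :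
  0 < c -> 0 < w -> dom c w s r phi z ->
  pr2 G (geo_r c w) s r phi z r1 phi1 z1 r2 phi2 z2 =
  ddot (cr G) s r phi z r1 phi1 z1 r2 phi2 z2
  - ddot (cs G) s r phi z r1 phi1 z1 r2 phi2 z2 * r1
  - 2 * dot (cs G) s r phi z r1 phi1 z1 * r2
  - cr G s r phi z * cdA c w r * phi1 ^ 2
  - 2 * cA c w r * phi1 *
    (dot (cphi G) s r phi z r1 phi1 z1 - dot (cs G) s r phi z r1 phi1 z1 * phi1).
Proof.
  intros hc hw H; destruct (dom_pos _ _ _ _ _ _ hc hw H) as [Hr HD].
  unfold pr2, pr1, geo_r.
  pose proof (is_derive_cA c w r HD) as DA.
  rewrite !Derive_const.
  rewrite (Derive_value (fun t => r2 - c ^ 4 * t / (c ^ 2 - w ^ 2 * t ^ 2) ^ 2 * phi1 ^ 2) r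
    (- (cdA c w r * phi1 ^ 2))) by (change (is_derive (fun t => r2 - cA c w t * phi1 ^ 2) r (- (cdA c w r * phi1 ^ 2))); derive).
  rewrite (Derive_value (fun t => r2 - c ^ 4 * r / (c ^ 2 - w ^ 2 * r ^ 2) ^ 2 * t ^ 2) phi1
    (- (2 * cA c w r * phi1))) by (fold (cA c w r); auto_derive; [exact I | ring]).
  rewrite (Derive_value (fun t => t - c ^ 4 * r / (c ^ 2 - w ^ 2 * r ^ 2) ^ 2 * phi1 ^ 2) r2
    1) by (auto_derive; [exact I | ring]).
  ring.
Qed.

Lemma pr2_geo_phi c w G s r phi z r1 phi1 z1 r2 phi2 z2 :
  0 < c -> 0 < w -> dom c w s r phi z ->
  pr2 G (geo_phi c w) s r phi z r1 phi1 z1 r2 phi2 z2 =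
  ddot (cphi G) s r phi z r1 phi1 z1 r2 phi2 z2
  - ddot (cs G) s r phi z r1 phi1 z1 r2 phi2 z2 * phi1
  - 2 * dot (cs G) s r phi z r1 phi1 z1 * phi2
  + cr G s r phi z * cdP c w r * phi1 * r1
  + cP c w r * r1 *
    (dot (cphi G) s r phi z r1 phi1 z1 - dot (cs G) s r phi z r1 phi1 z1 * phi1)
  + cP c w r * phi1 *
    (dot (cr G) s r phi z r1 phi1 z1 - dot (cs G) s r phi z r1 phi1 z1 * r1).
Proof.
  intros hc hw H; destruct (dom_pos _ _ _ _ _ _ hc hw H) as [Hr HD].
  unfold pr2, pr1, geo_phi.
  pose proof (is_derive_cP c w r Hr HD) as DP.
  rewrite !Derive_const.
  rewrite (Derive_value (fun t => phi2 + 2 * c ^ 2 / (t * (c ^ 2 - w ^ 2 * t ^ 2)) * phi1 * r1) r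
    (cdP c w r * phi1 * r1)) by (change (is_derive (fun t => phi2 + cP c w t * phi1 * r1) r (cdP c w r * phi1 * r1)); derive).
  rewrite (Derive_value (fun t => phi2 + 2 * c ^ 2 / (r * (c ^ 2 - w ^ 2 * r ^ 2)) * t * r1) phi1
    (cP c w r * r1)) by (fold (cP c w r); auto_derive; [exact I | ring]).
  rewrite (Derive_value (fun t => phi2 + 2 * c ^ 2 / (r * (c ^ 2 - w ^ 2 * r ^ 2)) * phi1 * t) r1
    (cP c w r * phi1)) by (fold (cP c w r); auto_derive; [exact I | ring]).
  rewrite (Derive_value (fun t => t + 2 * c ^ 2 / (r * (c ^ 2 - w ^ 2 * r ^ 2)) * phi1 * r1) phi2
    1) by (auto_derive; [exact I | ring]).
  ring.
Qed.

Lemma pr2_geo_z c w G s r phi z r1 phi1 z1 r2 phi2 z2 :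
  pr2 G (geo_z c w) s r phi z r1 phi1 z1 r2 phi2 z2 =
  ddot (cz G) s r phi z r1 phi1 z1 r2 phi2 z2
  - ddot (cs G) s r phi z r1 phi1 z1 r2 phi2 z2 * z1
  - 2 * dot (cs G) s r phi z r1 phi1 z1 * z2.
Proof. unfold pr2, pr1, geo_z; rewrite !Derive_const, Derive_id; ring. Qed.

(** Ten coefficients are determined by the values at ten points. *)
Lemma quadratic_zero a ax ay az axx ayy azz axy axz ayz :
  (forall x y z : R, a + ax * x + ay * y + az * z + axx * x ^ 2 + ayy * y ^ 2
     + azz * z ^ 2 + axy * x * y + axz * x * z + ayz * y * z = 0) ->
  (a = 0 /\ ax = 0 /\ ay = 0 /\ az = 0 /\ axx = 0) /\
  (ayy = 0 /\ azz = 0 /\ axy = 0 /\ axz = 0 /\ ayz = 0).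
Proof.
  intros H.
  pose proof (H 0 0 0). pose proof (H 1 0 0). pose proof (H (-1) 0 0).
  pose proof (H 0 1 0). pose proof (H 0 (-1) 0). pose proof (H 0 0 1).
  pose proof (H 0 0 (-1)). pose proof (H 1 1 0). pose proof (H 1 0 1).
  pose proof (H 0 1 1).
  repeat split; lra.
Qed.

(* The cubic part is a quadratic form times [z], as in the term - D^2(Sigma) z'
   of the determining equation of z'' = 0. *)
Lemma cubic_zero a ax ay az axx ayy azz axy axz ayz bxx byy bzz bxy bxz byz :
  (forall x y z : R, a + ax * x + ay * y + az * z + axx * x ^ 2 + ayy * y ^ 2
     + azz * z ^ 2 + axy * x * y + axz * x * z + ayz * y * z
     + z * (bxx * x ^ 2 + byy * y ^ 2 + bzz * z ^ 2 + bxy * x * y + bxz * x * z + byz * y * z)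
     = 0) ->
  ((bxx = 0 /\ byy = 0 /\ bzz = 0) /\ (bxy = 0 /\ bxz = 0 /\ byz = 0)) /\
  (a = 0 /\ ax = 0 /\ ay = 0 /\ az = 0 /\ axx = 0) /\
  (ayy = 0 /\ azz = 0 /\ axy = 0 /\ axz = 0 /\ ayz = 0).
Proof.
  intros H.
  assert (K : (bxx = 0 /\ byy = 0 /\ bzz = 0) /\ (bxy = 0 /\ bxz = 0 /\ byz = 0)).
  { pose proof (H 0 0 0). pose proof (H 0 0 1). pose proof (H 0 0 (-1)).
    (* On this axis the points 0, 1 and -1 give only az + bzz; a fourth point separates the linear
       from the cubic term. *)
    pose proof (H 0 0 2).
    pose proof (H 1 0 0). pose proof (H (-1) 0 0). pose proof (H 0 1 0). pose proof (H 0 (-1) 0).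
    pose proof (H 1 0 1). pose proof (H (-1) 0 1). pose proof (H 1 0 (-1)). pose proof (H (-1) 0 (-1)).
    pose proof (H 0 1 1). pose proof (H 0 (-1) 1). pose proof (H 0 1 (-1)). pose proof (H 0 (-1) (-1)).
    pose proof (H 1 1 0). pose proof (H 1 1 1). pose proof (H 1 1 (-1)).
    repeat split; lra. }
  split; [exact K |].
  destruct K as ((-> & -> & ->) & (-> & -> & ->)).
  apply quadratic_zero; intros x y z; rewrite <- (H x y z); ring.
Qed.

(** * Consequences of curvature *)

(** An identity on an open set may be differentiated. The derivative enters as an arbitrary [l], so
    that callers state it in expanded form and [derive] checks it. *)
Lemma zero_along_r c w (f : fn0) :
  (forall s r phi z, dom c w s r phi z -> f s r phi z = 0) ->
  forall s r phi z (l : R), dom c w s r phi z -> is_derive (fun t => f s t phi z) r l -> l = 0.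
Proof.
  intros E s r phi z l H D.
  rewrite <- (Derive_value _ _ _ D).
  transitivity (d_r (cst 0) s r phi z); [exact (agree_d_r c w f (cst 0) E s r phi z H) |].
  exact (Derive_const 0 _).
Qed.

Lemma zero_along_phi c w (f : fn0) :
  (forall s r phi z, dom c w s r phi z -> f s r phi z = 0) ->
  forall s r phi z (l : R), dom c w s r phi z -> is_derive (fun t => f s r t z) phi l -> l = 0.
Proof.
  intros E s r phi z l H D.
  rewrite <- (Derive_value _ _ _ D).
  transitivity (d_phi (cst 0) s r phi z); [exact (agree_d_phi c w f (cst 0) E s r phi z H) |].
  exact (Derive_const 0 _).
Qed.

Ltac along lem E := eapply (lem _ _ _ E); [eassumption | cbv beta; derive].

(* With f^2 = r^2 / (1 - w^2 r^2 / c^2) one has A = f f' and P = 2 f' / f, so that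
   A' - P A / 2 = f f'' and P' + P^2 / 2 = 2 f'' / f; neither vanishes because the
   curvature - f'' / f of the (r, phi)-surface does not. *)
Lemma curvature_AP c w r : 0 < c -> 0 < w -> 0 < r -> 0 < c ^ 2 - w ^ 2 * r ^ 2 ->
  cdA c w r - cP c w r * cA c w r / 2 <> 0.
Proof.
  intros hc hw hr hD.
  replace (cdA c w r - cP c w r * cA c w r / 2)
    with (3 * c ^ 4 * w ^ 2 * r ^ 2 / (c ^ 2 - w ^ 2 * r ^ 2) ^ 3)
    by (unfold cdA, cP, cA; field; lra).
  apply Rgt_not_eq, Rdiv_lt_0_compat; repeat apply Rmult_lt_0_compat; try lra; now apply pow_lt.
Qed.

Lemma curvature_P c w r : 0 < c -> 0 < w -> 0 < r -> 0 < c ^ 2 - w ^ 2 * r ^ 2 ->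
  cdP c w r + cP c w r ^ 2 / 2 <> 0.
Proof.
  intros hc hw hr hD.
  replace (cdP c w r + cP c w r ^ 2 / 2)
    with (6 * c ^ 2 * w ^ 2 / (c ^ 2 - w ^ 2 * r ^ 2) ^ 2)
    by (unfold cdP, cP; field; lra).
  apply Rgt_not_eq, Rdiv_lt_0_compat; repeat apply Rmult_lt_0_compat; try lra; now apply pow_lt.
Qed.

Lemma cP_neq_0 c w r : 0 < c -> 0 < r -> 0 < c ^ 2 - w ^ 2 * r ^ 2 -> cP c w r <> 0.
Proof.
  intros hc hr hD; apply Rgt_not_eq, Rdiv_lt_0_compat.
  - apply Rmult_lt_0_compat; [lra | now apply pow_lt].
  - now apply Rmult_lt_0_compat.
Qed.

Lemma Rmult_eq_0_reg (k x : R) : k <> 0 -> k * x = 0 -> x = 0.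
Proof. intros Hk H; apply Rmult_integral in H; tauto. Qed.

(* The hypotheses say that the covariant Hessian of F on the (r, phi)-surface
   vanishes. *)
Lemma hessian_zero c w F : 0 < c -> 0 < w -> smooth_on (dom c w) F ->
  (forall s r phi z, dom c w s r phi z -> d_r (d_r F) s r phi z = 0) ->
  (forall s r phi z, dom c w s r phi z ->
    d_phi (d_phi F) s r phi z + cA c w r * d_r F s r phi z = 0) ->
  (forall s r phi z, dom c w s r phi z ->
    2 * d_r (d_phi F) s r phi z - cP c w r * d_phi F s r phi z = 0) ->
  forall s r phi z, dom c w s r phi z -> d_r F s r phi z = 0 /\ d_phi F s r phi z = 0.
Proof.
  intros hc hw HF Hrr Hpp Hrp.
  assert (Fr : forall s r phi z, dom c w s r phi z -> d_r F s r phi z = 0).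
  { intros s r phi z H; destruct (dom_pos _ _ _ _ _ _ hc hw H) as [hr hD].
    pose proof (is_derive_cA _ _ _ hD) as DA.
    (* Both identities contain the third derivative F_{r phi phi}; eliminating it leaves (A' - P A /
       2) F_r = 0. *)
    assert (E1 : d_r (d_phi (d_phi F)) s r phi z + (cdA c w r * d_r F s r phi z
      + cA c w r * d_r (d_r F) s r phi z) = 0) by along zero_along_r Hpp.
    assert (E2 : 2 * d_phi (d_r (d_phi F)) s r phi z
      - cP c w r * d_phi (d_phi F) s r phi z = 0) by along zero_along_phi Hrp.
    destruct (smooth_schwarz c w (d_phi F) s r phi z ltac:(auto with smth) H)
      as (_ & _ & _ & S & _ & _).
    pose proof (Hpp _ _ _ _ H) as E3; pose proof (Hrr _ _ _ _ H) as E4.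
    apply (Rmult_eq_0_reg (cdA c w r - cP c w r * cA c w r / 2)).
    { now apply curvature_AP. }
    rewrite E4 in E1; rewrite S in E2.
    replace (d_phi (d_phi F) s r phi z) with (- cA c w r * d_r F s r phi z) in E2 by lra.
    lra. }
  intros s r phi z H; destruct (dom_pos _ _ _ _ _ _ hc hw H) as [hr hD].
  split; [now apply Fr |].
  assert (E1 : d_phi (d_r F) s r phi z = 0) by along zero_along_phi Fr.
  destruct (smooth_schwarz c w F s r phi z HF H) as (_ & _ & _ & S & _ & _).
  apply (Rmult_eq_0_reg (cP c w r)); [now apply cP_neq_0 |].
  pose proof (Hrp _ _ _ _ H); lra.
Qed.

(* The hypotheses say that the field V d/dr + W d/dphi has covariant derivative
   l times the identity. *)
Lemma homothetic_parallel_zero c w V W l : 0 < c -> 0 < w ->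
  smooth_on (dom c w) V -> smooth_on (dom c w) W -> smooth_on (dom c w) l ->
  (forall s r phi z, dom c w s r phi z ->
    d_r V s r phi z - l s r phi z = 0) ->
  (forall s r phi z, dom c w s r phi z ->
    d_phi V s r phi z - cA c w r * W s r phi z = 0) ->
  (forall s r phi z, dom c w s r phi z ->
    2 * d_r W s r phi z + cP c w r * W s r phi z = 0) ->
  (forall s r phi z, dom c w s r phi z ->
    2 * d_phi W s r phi z - 2 * l s r phi z + cP c w r * V s r phi z = 0) ->
  (forall s r phi z, dom c w s r phi z -> d_r l s r phi z = 0 /\ d_phi l s r phi z = 0) ->
  forall s r phi z, dom c w s r phi z ->
    V s r phi z = 0 /\ W s r phi z = 0 /\ l s r phi z = 0.
Proof.
  intros hc hw HV HW Hl Vr Vp Wr Wp Hl0.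
  assert (W0 : forall s r phi z, dom c w s r phi z -> W s r phi z = 0).
  { intros s r phi z H; destruct (dom_pos _ _ _ _ _ _ hc hw H) as [hr hD].
    pose proof (is_derive_cA _ _ _ hD) as DA.
    (* The two expressions for V_{r phi}, with l_phi = 0 and W_r = - P W / 2, give (A' - P A / 2) W
       = 0. *)
    assert (E1 : d_phi (d_r V) s r phi z - d_phi l s r phi z = 0)
      by along zero_along_phi Vr.
    assert (E2 : d_r (d_phi V) s r phi z
      - (cdA c w r * W s r phi z + cA c w r * d_r W s r phi z) = 0)
      by along zero_along_r Vp.
    destruct (smooth_schwarz c w V s r phi z HV H) as (_ & _ & _ & S & _ & _).
    destruct (Hl0 _ _ _ _ H) as [_ L].
    apply (Rmult_eq_0_reg (cdA c w r - cP c w r * cA c w r / 2)).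
    { now apply curvature_AP. }
    replace (d_r W s r phi z) with (- cP c w r * W s r phi z / 2) in E2
      by (pose proof (Wr _ _ _ _ H); lra).
    lra. }
  assert (Vl : forall s r phi z, dom c w s r phi z ->
    2 * l s r phi z - cP c w r * V s r phi z = 0).
  { intros s r phi z H.
    assert (E : d_phi W s r phi z = 0) by along zero_along_phi W0.
    pose proof (Wp _ _ _ _ H); lra. }
  intros s r phi z H; destruct (dom_pos _ _ _ _ _ _ hc hw H) as [hr hD].
  pose proof (is_derive_cP _ _ _ hr hD) as DP.
  (* Differentiating 2 l = P V in r, with l_r = 0 and V_r = l = P V / 2, gives (P' + P^2 / 2) V =
     0. *)
  assert (E : 2 * d_r l s r phi z
    - (cdP c w r * V s r phi z + cP c w r * d_r V s r phi z) = 0)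
    by along zero_along_r Vl.
  pose proof (Vl _ _ _ _ H) as E1; destruct (Hl0 _ _ _ _ H) as [L _].
  assert (V0 : V s r phi z = 0).
  { apply (Rmult_eq_0_reg (cdP c w r + cP c w r ^ 2 / 2)).
    { now apply curvature_P. }
    replace (d_r V s r phi z) with (cP c w r * V s r phi z / 2) in E
      by (pose proof (Vr _ _ _ _ H); lra).
    lra. }
  rewrite V0 in E1; split; [exact V0 | split; [now apply W0 | lra]].
Qed.

(* The hypotheses say that V d/dr + W d/dphi is an affine field; it therefore
   preserves the Ricci tensor, which is what [Ric_rp] and [Div] below express. *)
Lemma affine_field_zero c w V W : 0 < c -> 0 < w ->
  smooth_on (dom c w) V -> smooth_on (dom c w) W ->
  (forall s r phi z, dom c w s r phi z -> d_r (d_r V) s r phi z = 0) ->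
  (forall s r phi z, dom c w s r phi z ->
    d_phi (d_phi V) s r phi z + cA c w r * d_r V s r phi z
    - cdA c w r * V s r phi z - 2 * cA c w r * d_phi W s r phi z = 0) ->
  (forall s r phi z, dom c w s r phi z ->
    2 * d_r (d_phi V) s r phi z - cP c w r * d_phi V s r phi z
    - 2 * cA c w r * d_r W s r phi z = 0) ->
  (forall s r phi z, dom c w s r phi z ->
    d_r (d_r W) s r phi z + cP c w r * d_r W s r phi z = 0) ->
  (forall s r phi z, dom c w s r phi z ->
    2 * d_r (d_phi W) s r phi z + cdP c w r * V s r phi z
    + cP c w r * d_r V s r phi z = 0) ->
  forall s r phi z, dom c w s r phi z ->
    V s r phi z = 0 /\ d_r W s r phi z = 0 /\ d_phi W s r phi z = 0.
Proof.
  intros hc hw HV HW Vrr Vpp Vrp Wrr Wrp.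
  assert (Ric_rp : forall s r phi z, dom c w s r phi z ->
    (c ^ 2 - w ^ 2 * (r * r)) * d_phi V s r phi z + c ^ 2 * (r * r) * d_r W s r phi z = 0).
  { intros s r phi z H; destruct (dom_pos _ _ _ _ _ _ hc hw H) as [hr hD].
    pose proof (is_derive_cA _ _ _ hD) as DA; pose proof (is_derive_cP _ _ _ hr hD) as DP.
    assert (E1 : d_phi (d_r (d_r V)) s r phi z = 0) by along zero_along_phi Vrr.
    assert (E2 : 2 * d_r (d_r (d_phi V)) s r phi z
      - (cdP c w r * d_phi V s r phi z + cP c w r * d_r (d_phi V) s r phi z)
      - 2 * (cdA c w r * d_r W s r phi z + cA c w r * d_r (d_r W) s r phi z) = 0)
      by along zero_along_r Vrp.
    destruct (smooth_schwarz c w (d_r V) s r phi z ltac:(auto with smth) H)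
      as (_ & _ & _ & S1 & _ & _).
    assert (S2 : d_r (d_phi (d_r V)) s r phi z = d_r (d_r (d_phi V)) s r phi z).
    { apply (agree_d_r c w); [| exact H].
      intros s' r' phi' z' H'; apply (smooth_schwarz c w V s' r' phi' z' HV H'). }
    rewrite <- S2, <- S1, E1 in E2.
    replace (d_r (d_phi V) s r phi z)
      with (cP c w r * d_phi V s r phi z / 2 + cA c w r * d_r W s r phi z) in E2
      by (pose proof (Vrp _ _ _ _ H); lra).
    replace (d_r (d_r W) s r phi z) with (- cP c w r * d_r W s r phi z) in E2
      by (pose proof (Wrr _ _ _ _ H); lra).
    (* [E2] now reads - (P' + P^2 / 2) V_phi - 2 (A' - P A / 2) W_r = 0, and this is the common
       factor of its coefficients. *)
    apply (Rmult_eq_0_reg (- (6 * c ^ 2 * w ^ 2) / (c ^ 2 - w ^ 2 * r ^ 2) ^ 3)).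
    { apply Rlt_not_eq; unfold Rdiv; rewrite Ropp_mult_distr_l_reverse.
      apply Ropp_lt_gt_0_contravar, Rdiv_lt_0_compat; repeat apply Rmult_lt_0_compat; try lra;
      now apply pow_lt. }
    rewrite <- E2; unfold cdP, cP, cdA, cA; field; lra. }
  (* With K = - 3 c^2 w^2 / (c^2 - w^2 r^2)^2 the Gaussian curvature, the first identity is K_r V +
     2 K V_r = 0, the rr component, up to a factor; the second compares it with the phi phi
     component. The form [r * r] suits [derive], whose rules treat products but not powers. *)
  assert (Div : forall s r phi z, dom c w s r phi z ->
    (c ^ 2 - w ^ 2 * (r * r)) * d_r V s r phi z + r * (2 * w ^ 2) * V s r phi z = 0 /\
    d_phi W s r phi z = d_r V s r phi z - cP c w r * V s r phi z / 2).
  { intros s r phi z H; destruct (dom_pos _ _ _ _ _ _ hc hw H) as [hr hD].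
    pose proof (is_derive_cA _ _ _ hD) as DA; pose proof (is_derive_cP _ _ _ hr hD) as DP.
    pose proof (is_derive_cdA _ _ _ hD) as DdA.
    assert (E1 : d_r (d_phi (d_phi V)) s r phi z
      + (cdA c w r * d_r V s r phi z + cA c w r * d_r (d_r V) s r phi z)
      - (cddA c w r * V s r phi z + cdA c w r * d_r V s r phi z)
      - 2 * (cdA c w r * d_phi W s r phi z + cA c w r * d_r (d_phi W) s r phi z) = 0)
      by along zero_along_r Vpp.
    assert (E2 : 2 * d_phi (d_r (d_phi V)) s r phi z
      - cP c w r * d_phi (d_phi V) s r phi z
      - 2 * cA c w r * d_phi (d_r W) s r phi z = 0) by along zero_along_phi Vrp.
    assert (E3 : (c ^ 2 - w ^ 2 * (r * r)) * d_phi (d_phi V) s r phi z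
      + c ^ 2 * (r * r) * d_phi (d_r W) s r phi z = 0) by along zero_along_phi Ric_rp.
    destruct (smooth_schwarz c w (d_phi V) s r phi z ltac:(auto with smth) H)
      as (_ & _ & _ & S1 & _ & _).
    destruct (smooth_schwarz c w W s r phi z HW H) as (_ & _ & _ & S2 & _ & _).
    rewrite S1 in E2; rewrite S2 in E2, E3.
    pose proof (Vpp _ _ _ _ H) as F1; pose proof (Vrr _ _ _ _ H) as F2.
    pose proof (Wrp _ _ _ _ H) as F3.
    rewrite F2 in E1.
    replace (d_r (d_phi W) s r phi z)
      with (- (cdP c w r * V s r phi z + cP c w r * d_r V s r phi z) / 2) in * by lra.
    replace (d_phi (d_phi V) s r phi z)
      with (cdA c w r * V s r phi z + 2 * cA c w r * d_phi W s r phi z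
            - cA c w r * d_r V s r phi z) in * by lra.
    replace (d_r (d_phi (d_phi V)) s r phi z)
      with (cddA c w r * V s r phi z
        + 2 * (cdA c w r * d_phi W s r phi z
        + cA c w r * (- (cdP c w r * V s r phi z + cP c w r * d_r V s r phi z) / 2))) in E2 by lra.
    assert (T : d_phi W s r phi z = d_r V s r phi z - cP c w r * V s r phi z / 2).
    { apply Rminus_diag_uniq.
      (* The factor is 2 (c^2 - w^2 r^2) A, the coefficient of W_phi in [E3]. *)
      apply (Rmult_eq_0_reg (2 * c ^ 4 * r / (c ^ 2 - w ^ 2 * r ^ 2))).
      { apply Rgt_not_eq, Rdiv_lt_0_compat; repeat apply Rmult_lt_0_compat; try lra;
        now apply pow_lt. }
      rewrite <- E3; unfold cdP, cP, cdA, cA; field; lra. }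
    split; [| exact T].
    rewrite T in E2.
    (* The factor is 4 (A' - P A / 2) / (c^2 - w^2 r^2): the coefficient of V_r in [E2] is 4 (A' - P
       A / 2). *)
    apply (Rmult_eq_0_reg (12 * c ^ 4 * w ^ 2 * r ^ 2 / (c ^ 2 - w ^ 2 * r ^ 2) ^ 4)).
    { apply Rgt_not_eq, Rdiv_lt_0_compat; repeat apply Rmult_lt_0_compat; try lra;
      now apply pow_lt. }
    rewrite <- E2; unfold cddA, cdP, cP, cdA, cA; field; lra. }
  assert (V0 : forall s r phi z, dom c w s r phi z -> V s r phi z = 0).
  { intros s r phi z H; destruct (dom_pos _ _ _ _ _ _ hc hw H) as [hr hD].
    pose proof (fun s r phi z H => proj1 (Div s r phi z H)) as E.
    (* The terms in V_r cancel and V_rr = 0, which leaves 2 w^2 V = 0; this term stems from the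
       derivative of the curvature. *)
    assert (E1 : (- w ^ 2 * (r + r)) * d_r V s r phi z
      + (c ^ 2 - w ^ 2 * (r * r)) * d_r (d_r V) s r phi z
      + (2 * w ^ 2 * V s r phi z + r * (2 * w ^ 2) * d_r V s r phi z) = 0)
      by along zero_along_r E.
    rewrite (Vrr _ _ _ _ H) in E1.
    apply (Rmult_eq_0_reg (2 * w ^ 2)); [| lra].
    apply Rgt_not_eq, Rmult_lt_0_compat; [lra | now apply pow_lt]. }
  intros s r phi z H; destruct (dom_pos _ _ _ _ _ _ hc hw H) as [hr hD].
  assert (Er : d_r V s r phi z = 0) by along zero_along_r V0.
  assert (Ep : d_phi V s r phi z = 0) by along zero_along_phi V0.
  split; [now apply V0 | split].
  - pose proof (Ric_rp _ _ _ _ H) as E; rewrite Ep in E.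
    apply (Rmult_eq_0_reg (c ^ 2 * (r * r))); [| lra].
    apply Rgt_not_eq; repeat apply Rmult_lt_0_compat; lra.
  - rewrite (proj2 (Div _ _ _ _ H)), Er, (V0 _ _ _ _ H); lra.
Qed.

(** * Integration to affine functions of s and z *)

(** Constants and zero are also written in this form, as [affine_sz k 0 0], so that one calculus
    covers all four coefficients of a symmetry. *)
Definition affine_sz (a b d : R) : fn0 := fun s r phi z => a + b * s + d * z.

Lemma eq_of_derive_zero (f : R -> R) a b :
  (forall t, Rmin a b <= t <= Rmax a b -> is_derive f t 0) -> f a = f b.
Proof.
  intros H; destruct (Rtotal_order a b) as [L | [-> | L]]; [| reflexivity |].
  - rewrite Rmin_left, Rmax_right in H by lra; exact (eq_is_derive f a b H L).
  - rewrite Rmin_right, Rmax_left in H by lra; symmetry; exact (eq_is_derive f b a H L).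
Qed.

(** Integration along segments parallel to the axes, which stay in the domain because it is a
    product of intervals. The base point has r = c / w / 2, the midpoint of the interval. *)
Lemma affine_of_partials c w F b d : 0 < c -> 0 < w -> smooth_on (dom c w) F ->
  (forall s r phi z, dom c w s r phi z ->
     d_s F s r phi z = b /\ d_r F s r phi z = 0 /\
     d_phi F s r phi z = 0 /\ d_z F s r phi z = d) ->
  exists a, agree (dom c w) F (affine_sz a b d).
Proof.
  intros hc hw HF H0; exists (F 0 (c / w / 2) 0 0); intros s r phi z H; unfold affine_sz.
  assert (hcw : 0 < c / w) by now apply Rdiv_lt_0_compat.
  assert (Hm : forall phi z, dom c w 0 (c / w / 2) phi z) by (unfold dom; intros; lra).
  assert (E1 : F s r phi z - b * s = F 0 r phi z - b * 0).
  { apply (eq_of_derive_zero (fun t => F t r phi z - b * t)); intros t _.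
    change (dom c w t r phi z) in H; derive.
    rewrite (proj1 (H0 _ _ _ _ H)); ring. }
  assert (E2 : F 0 r phi z = F 0 (c / w / 2) phi z).
  { apply (eq_of_derive_zero (fun t => F 0 t phi z)); intros t Ht.
    assert (Hd : dom c w 0 t phi z).
    { destruct H as [h1 h2]; revert Ht; unfold dom, Rmin, Rmax.
      destruct (Rle_dec r (c / w / 2)); lra. }
    apply is_derive_value with (1 := is_derive_r (dom c w) F 0 t phi z HF Hd), H0, Hd. }
  assert (E3 : F 0 (c / w / 2) phi z = F 0 (c / w / 2) 0 z).
  { apply (eq_of_derive_zero (fun t => F 0 (c / w / 2) t z)); intros t _.
    apply is_derive_value with (1 := is_derive_phi (dom c w) F 0 _ t z HF (Hm _ _)), H0, Hm. }
  assert (E4 : F 0 (c / w / 2) 0 z - d * z = F 0 (c / w / 2) 0 0 - d * 0).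
  { apply (eq_of_derive_zero (fun t => F 0 (c / w / 2) 0 t - d * t)); intros t _.
    pose proof (Hm 0 t) as Ht; derive.
    destruct (H0 _ _ _ _ Ht) as (_ & _ & _ & ->); ring. }
  lra.
Qed.

(** * Determining equations *)

Lemma d_s_affine_sz a b d s r phi z : d_s (affine_sz a b d) s r phi z = b.
Proof. apply Derive_value; unfold affine_sz; derive. Qed.

Lemma d_r_affine_sz a b d s r phi z : d_r (affine_sz a b d) s r phi z = 0.
Proof. apply Derive_value; unfold affine_sz; derive. Qed.

Lemma d_phi_affine_sz a b d s r phi z : d_phi (affine_sz a b d) s r phi z = 0.
Proof. apply Derive_value; unfold affine_sz; derive. Qed.

Lemma d_z_affine_sz a b d s r phi z : d_z (affine_sz a b d) s r phi z = d.
Proof. apply Derive_value; unfold affine_sz; derive. Qed.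

Lemma agree_d_affine c w F a b d : agree (dom c w) F (affine_sz a b d) ->
  agree (dom c w) (d_s F) (affine_sz b 0 0) /\ agree (dom c w) (d_r F) (affine_sz 0 0 0) /\
  agree (dom c w) (d_phi F) (affine_sz 0 0 0) /\ agree (dom c w) (d_z F) (affine_sz d 0 0).
Proof.
  intros E; repeat split; intros s r phi z H.
  - rewrite (agree_d_s _ _ _ _ E _ _ _ _ H), d_s_affine_sz; unfold affine_sz; ring.
  - rewrite (agree_d_r _ _ _ _ E _ _ _ _ H), d_r_affine_sz; unfold affine_sz; ring.
  - rewrite (agree_d_phi _ _ _ _ E _ _ _ _ H), d_phi_affine_sz; unfold affine_sz; ring.
  - rewrite (agree_d_z _ _ _ _ E _ _ _ _ H), d_z_affine_sz; unfold affine_sz; ring.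
Qed.

(** The induction closes because the partial derivatives agree with functions of the same form, with
    other parameters. *)
Lemma Ck_affine_sz c w k : forall a b d, Ck (dom c w) k (affine_sz a b d).
Proof.
  assert (Hc : forall a b d, Defs.continuous_on (dom c w) (affine_sz a b d)).
  { intros a b d s r phi z _; unfold affine_sz.
    apply (continuous_plus (fun p : R * R * R * R => a + b * fst (fst (fst p)))
      (fun p => d * snd p)).
    - apply (continuous_plus (fun p : R * R * R * R => a)
        (fun p => b * fst (fst (fst p)))); [apply continuous_const |].
      apply (continuous_mult (fun p : R * R * R * R => b) (fun p => fst (fst (fst p))));
        [apply continuous_const |].
      apply (continuous_comp (fun p : R * R * R * R => fst (fst p)) fst);
        [apply (continuous_comp (fun p : R * R * R * R => fst p) fst) |]; apply continuous_fst.
    - apply (continuous_mult (fun p : R * R * R * R => d) (fun p => snd p));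
        [apply continuous_const | apply continuous_snd]. }
  induction k as [|k IH]; intros a b d; split; [apply Hc | exact I | apply Hc |].
  destruct (agree_d_affine c w _ a b d (fun _ _ _ _ _ => eq_refl)) as (Es & Er & Ep & Ez).
  split; [| repeat split; (eapply Ck_agree; [apply agree_sym; eassumption | apply IH])].
  intros s r phi z _; unfold affine_sz; repeat split; auto_derive; exact I.
Qed.

Lemma smooth_affine c w F a b d :
  agree (dom c w) F (affine_sz a b d) -> smooth_on (dom c w) F.
Proof.
  intros E; apply smooth_on_agree with (affine_sz a b d); [now apply agree_sym |].
  intros k; apply Ck_affine_sz.
Qed.

Lemma dot_affine c w F a b d s r phi z r1 phi1 z1 :
  agree (dom c w) F (affine_sz a b d) -> dom c w s r phi z ->
  dot F s r phi z r1 phi1 z1 = b + d * z1.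
Proof.
  intros E H; destruct (agree_d_affine _ _ _ _ _ _ E) as (Es & Er & Ep & Ez).
  unfold dot; rewrite (Es _ _ _ _ H), (Er _ _ _ _ H), (Ep _ _ _ _ H), (Ez _ _ _ _ H).
  unfold affine_sz; ring.
Qed.

Lemma ddot_affine c w F a b d s r phi z r1 phi1 z1 r2 phi2 z2 :
  agree (dom c w) F (affine_sz a b d) -> dom c w s r phi z ->
  ddot F s r phi z r1 phi1 z1 r2 phi2 z2 = d * z2.
Proof.
  intros E H.
  rewrite (ddot_smooth c w) by (auto; eapply smooth_affine, E).
  destruct (agree_d_affine _ _ _ _ _ _ E) as (Es & Er & Ep & Ez).
  destruct (agree_d_affine _ _ _ _ _ _ Es) as (Ess & _ & _ & _).
  destruct (agree_d_affine _ _ _ _ _ _ Er) as (Esr & Err & _ & _).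
  destruct (agree_d_affine _ _ _ _ _ _ Ep) as (Esp & Erp & Epp & _).
  destruct (agree_d_affine _ _ _ _ _ _ Ez) as (Esz & Erz & Epz & Ezz).
  rewrite (Er _ _ _ _ H), (Ep _ _ _ _ H), (Ez _ _ _ _ H), (Ess _ _ _ _ H), (Esr _ _ _ _ H),
    (Err _ _ _ _ H), (Esp _ _ _ _ H), (Erp _ _ _ _ H), (Epp _ _ _ _ H), (Esz _ _ _ _ H),
    (Erz _ _ _ _ H), (Epz _ _ _ _ H), (Ezz _ _ _ _ H).
  unfold affine_sz; ring.
Qed.

(** The [a] and [b] parameters describe an affine field of the (s, z)-plane, [p] a rotation about
    the z-axis. *)
Definition sym_field (a0 a1 a2 p b0 b1 b2 : R) : vfield :=
  VField (affine_sz a0 a1 a2) (affine_sz 0 0 0) (affine_sz p 0 0) (affine_sz b0 b1 b2).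

Lemma vf_eq_sym_field U G a0 a1 a2 p b0 b1 b2 :
  vf_eq U G (sym_field a0 a1 a2 p b0 b1 b2) <->
  agree U (cs G) (affine_sz a0 a1 a2) /\ agree U (cr G) (affine_sz 0 0 0) /\
  agree U (cphi G) (affine_sz p 0 0) /\ agree U (cz G) (affine_sz b0 b1 b2).
Proof.
  split.
  - intros E; repeat split; intros s r phi z H; apply (E s r phi z H).
  - intros (E1 & E2 & E3 & E4) s r phi z H; simpl; auto.
Qed.

(** Since z'' = 0 on geodesics, [ddot] of every coefficient vanishes. The remaining terms in
    D(Sigma) cancel, because the accelerations are quadratic in the velocities. *)
Lemma point_symmetry_sym_field c w G a0 a1 a2 p b0 b1 b2 : 0 < c -> 0 < w ->
  vf_eq (dom c w) G (sym_field a0 a1 a2 p b0 b1 b2) -> point_symmetry c w G.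
Proof.
  intros hc hw E; apply vf_eq_sym_field in E; destruct E as (Es & Er & Ep & Ez).
  split; [repeat split; eapply smooth_affine; eassumption |].
  intros s r phi z r1 phi1 z1 r2 phi2 z2 H (Hr & Hp & Hz).
  assert (Er2 : r2 = cA c w r * phi1 ^ 2) by (unfold geo_r, cA in *; lra).
  assert (Ep2 : phi2 = - cP c w r * phi1 * r1) by (unfold geo_phi, cP in *; lra).
  unfold geo_z in Hz; subst z2 r2 phi2.
  rewrite pr2_geo_r, pr2_geo_phi, pr2_geo_z by assumption.
  rewrite !(ddot_affine _ _ _ _ _ _ _ _ _ _ _ _ _ _ _ _ Es H),
    !(ddot_affine _ _ _ _ _ _ _ _ _ _ _ _ _ _ _ _ Er H),
    !(ddot_affine _ _ _ _ _ _ _ _ _ _ _ _ _ _ _ _ Ep H),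
    !(ddot_affine _ _ _ _ _ _ _ _ _ _ _ _ _ _ _ _ Ez H),
    !(dot_affine _ _ _ _ _ _ _ _ _ _ _ _ _ Es H),
    !(dot_affine _ _ _ _ _ _ _ _ _ _ _ _ _ Er H),
    !(dot_affine _ _ _ _ _ _ _ _ _ _ _ _ _ Ep H), (Er _ _ _ _ H).
  unfold affine_sz; repeat split; ring.
Qed.

(** Solving the equations for the accelerations leaves the velocities free, so that coefficients can
    be compared. *)
Lemma symmetry_on_shell c w G s r phi z r1 phi1 z1 :
  point_symmetry c w G -> dom c w s r phi z ->
  pr2 G (geo_r c w) s r phi z r1 phi1 z1
    (cA c w r * phi1 ^ 2) (- cP c w r * phi1 * r1) 0 = 0 /\
  pr2 G (geo_phi c w) s r phi z r1 phi1 z1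
    (cA c w r * phi1 ^ 2) (- cP c w r * phi1 * r1) 0 = 0 /\
  pr2 G (geo_z c w) s r phi z r1 phi1 z1
    (cA c w r * phi1 ^ 2) (- cP c w r * phi1 * r1) 0 = 0.
Proof.
  intros [_ HG] H; apply HG; [exact H |].
  unfold geodesic_system, geo_r, geo_phi, geo_z, cA, cP; repeat split; ring.
Qed.

Lemma determining_z c w G s r phi z : point_symmetry c w G -> dom c w s r phi z ->
  let S := cs G in let Z := cz G in
  ((d_r (d_r S) s r phi z = 0
   /\ d_phi (d_phi S) s r phi z + cA c w r * d_r S s r phi z = 0
   /\ d_z (d_z S) s r phi z = 0)
   /\ (2 * d_r (d_phi S) s r phi z - cP c w r * d_phi S s r phi z = 0
   /\ d_r (d_z S) s r phi z = 0 /\ d_phi (d_z S) s r phi z = 0))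
  /\ (d_s (d_s Z) s r phi z = 0
   /\ 2 * d_s (d_z Z) s r phi z = d_s (d_s S) s r phi z
   /\ d_r (d_r Z) s r phi z = 0)
  /\ (d_phi (d_phi Z) s r phi z + cA c w r * d_r Z s r phi z = 0
   /\ d_z (d_z Z) s r phi z = 2 * d_s (d_z S) s r phi z
   /\ 2 * d_r (d_phi Z) s r phi z - cP c w r * d_phi Z s r phi z = 0).
Proof.
  intros HG H S Z; pose proof HG as [(HS & _ & _ & HZ) _].
  assert (E : forall x y t,
    d_s (d_s Z) s r phi z + 2 * d_s (d_r Z) s r phi z * x
    + 2 * d_s (d_phi Z) s r phi z * y
    + (2 * d_s (d_z Z) s r phi z - d_s (d_s S) s r phi z) * t
    + d_r (d_r Z) s r phi z * x ^ 2
    + (d_phi (d_phi Z) s r phi z + cA c w r * d_r Z s r phi z) * y ^ 2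
    + (d_z (d_z Z) s r phi z - 2 * d_s (d_z S) s r phi z) * t ^ 2
    + (2 * d_r (d_phi Z) s r phi z - cP c w r * d_phi Z s r phi z) * x * y
    + (2 * d_r (d_z Z) s r phi z - 2 * d_s (d_r S) s r phi z) * x * t
    + (2 * d_phi (d_z Z) s r phi z - 2 * d_s (d_phi S) s r phi z) * y * t
    + t * (- d_r (d_r S) s r phi z * x ^ 2
    + - (d_phi (d_phi S) s r phi z + cA c w r * d_r S s r phi z) * y ^ 2
    + - d_z (d_z S) s r phi z * t ^ 2
    + - (2 * d_r (d_phi S) s r phi z - cP c w r * d_phi S s r phi z) * x * y
    + - (2 * d_r (d_z S) s r phi z) * x * t
    + - (2 * d_phi (d_z S) s r phi z) * y * t) = 0).
  { intros x y t.
    destruct (symmetry_on_shell c w G s r phi z x y t HG H) as (_ & _ & K).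
    rewrite <- K, pr2_geo_z, !(ddot_smooth c w) by assumption.
    unfold S, Z; ring. }
  apply cubic_zero in E; repeat split; lra.
Qed.

Definition depends_on_sz (F : fn0) s r phi z : Prop :=
  (d_r F s r phi z = 0 /\ d_phi F s r phi z = 0) /\
  (d_s (d_r F) s r phi z = 0 /\ d_s (d_phi F) s r phi z = 0 /\
   d_r (d_r F) s r phi z = 0 /\ d_phi (d_phi F) s r phi z = 0 /\
   d_r (d_phi F) s r phi z = 0 /\ d_r (d_z F) s r phi z = 0 /\
   d_phi (d_z F) s r phi z = 0).

(** The hypotheses on Sigma remove the cubic terms of D^2(Sigma) r', so the condition is quadratic
    in the velocities. *)
Lemma determining_r c w G s r phi z : 0 < c -> 0 < w ->
  point_symmetry c w G -> dom c w s r phi z ->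
  let S := cs G in let U := cr G in let V := cphi G in
  depends_on_sz S s r phi z -> d_z (d_z S) s r phi z = 0 ->
  (2 * d_s (d_r U) s r phi z = d_s (d_s S) s r phi z
   /\ d_s (d_phi U) s r phi z - cA c w r * d_s V s r phi z = 0
   /\ d_r (d_r U) s r phi z = 0)
  /\ (d_phi (d_phi U) s r phi z + cA c w r * d_r U s r phi z
      - cdA c w r * U s r phi z - 2 * cA c w r * d_phi V s r phi z = 0
   /\ 2 * d_r (d_phi U) s r phi z - cP c w r * d_phi U s r phi z
      - 2 * cA c w r * d_r V s r phi z = 0
   /\ d_r (d_z U) s r phi z = d_s (d_z S) s r phi z
   /\ d_phi (d_z U) s r phi z - cA c w r * d_z V s r phi z = 0).
Proof.
  intros hc hw HG H S U V ((S1 & S2) & S3 & S4 & S5 & S6 & S7 & S8 & S9) S10.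
  pose proof HG as [(HS & HU & HV & _) _].
  assert (E : forall x y t,
    d_s (d_s U) s r phi z + (2 * d_s (d_r U) s r phi z - d_s (d_s S) s r phi z) * x
    + 2 * (d_s (d_phi U) s r phi z - cA c w r * d_s V s r phi z) * y
    + 2 * d_s (d_z U) s r phi z * t
    + d_r (d_r U) s r phi z * x ^ 2
    + (d_phi (d_phi U) s r phi z + cA c w r * d_r U s r phi z
    - cdA c w r * U s r phi z - 2 * cA c w r * d_phi V s r phi z) * y ^ 2
    + d_z (d_z U) s r phi z * t ^ 2
    + (2 * d_r (d_phi U) s r phi z - cP c w r * d_phi U s r phi z
    - 2 * cA c w r * d_r V s r phi z) * x * y
    + 2 * (d_r (d_z U) s r phi z - d_s (d_z S) s r phi z) * x * t
    + 2 * (d_phi (d_z U) s r phi z - cA c w r * d_z V s r phi z) * y * t = 0).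
  { intros x y t.
    destruct (symmetry_on_shell c w G s r phi z x y t HG H) as (K & _ & _).
    rewrite <- K, pr2_geo_r, !(ddot_smooth c w) by assumption.
    unfold dot; fold S U V; rewrite S1, S2, S3, S4, S5, S6, S7, S8, S9, S10; ring. }
  apply quadratic_zero in E; repeat split; lra.
Qed.

Lemma determining_phi c w G s r phi z : 0 < c -> 0 < w ->
  point_symmetry c w G -> dom c w s r phi z ->
  let S := cs G in let U := cr G in let V := cphi G in
  depends_on_sz S s r phi z -> d_z (d_z S) s r phi z = 0 ->
  (2 * d_s (d_r V) s r phi z + cP c w r * d_s V s r phi z = 0
   /\ 2 * d_s (d_phi V) s r phi z - d_s (d_s S) s r phi z + cP c w r * d_s U s r phi z = 0
   /\ d_r (d_r V) s r phi z + cP c w r * d_r V s r phi z = 0)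
  /\ (2 * d_r (d_phi V) s r phi z + cdP c w r * U s r phi z
      + cP c w r * d_r U s r phi z = 0
   /\ 2 * d_r (d_z V) s r phi z + cP c w r * d_z V s r phi z = 0
   /\ 2 * d_phi (d_z V) s r phi z - 2 * d_s (d_z S) s r phi z
      + cP c w r * d_z U s r phi z = 0).
Proof.
  intros hc hw HG H S U V ((S1 & S2) & S3 & S4 & S5 & S6 & S7 & S8 & S9) S10.
  pose proof HG as [(HS & HU & HV & _) _].
  assert (E : forall x y t,
    d_s (d_s V) s r phi z
    + (2 * d_s (d_r V) s r phi z + cP c w r * d_s V s r phi z) * x
    + (2 * d_s (d_phi V) s r phi z - d_s (d_s S) s r phi z + cP c w r * d_s U s r phi z) * y
    + 2 * d_s (d_z V) s r phi z * t
    + (d_r (d_r V) s r phi z + cP c w r * d_r V s r phi z) * x ^ 2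
    + (d_phi (d_phi V) s r phi z + cA c w r * d_r V s r phi z
     + cP c w r * d_phi U s r phi z) * y ^ 2
    + d_z (d_z V) s r phi z * t ^ 2
    + (2 * d_r (d_phi V) s r phi z + cdP c w r * U s r phi z
    + cP c w r * d_r U s r phi z) * x * y
    + (2 * d_r (d_z V) s r phi z + cP c w r * d_z V s r phi z) * x * t
    + (2 * d_phi (d_z V) s r phi z - 2 * d_s (d_z S) s r phi z
    + cP c w r * d_z U s r phi z) * y * t = 0).
  { intros x y t.
    destruct (symmetry_on_shell c w G s r phi z x y t HG H) as (_ & K & _).
    rewrite <- K, pr2_geo_phi, !(ddot_smooth c w) by assumption.
    unfold dot; fold S U V; rewrite S1, S2, S3, S4, S5, S6, S7, S8, S9, S10; ring. }
  apply quadratic_zero in E; repeat split; lra.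
Qed.

Lemma depends_on_sz_intro c w F : smooth_on (dom c w) F ->
  (forall s r phi z, dom c w s r phi z -> d_r F s r phi z = 0 /\ d_phi F s r phi z = 0) ->
  forall s r phi z, dom c w s r phi z -> depends_on_sz F s r phi z.
Proof.
  intros HF E0 s r phi z H.
  assert (Er : agree (dom c w) (d_r F) (affine_sz 0 0 0)).
  { intros s' r' phi' z' H'; rewrite (proj1 (E0 _ _ _ _ H')); unfold affine_sz; ring. }
  assert (Ep : agree (dom c w) (d_phi F) (affine_sz 0 0 0)).
  { intros s' r' phi' z' H'; rewrite (proj2 (E0 _ _ _ _ H')); unfold affine_sz; ring. }
  destruct (agree_d_affine _ _ _ _ _ _ Er) as (Ers & Err & _ & Erz).
  destruct (agree_d_affine _ _ _ _ _ _ Ep) as (Eps & Epr & Epp & Epz).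
  destruct (smooth_schwarz c w F s r phi z HF H) as (_ & _ & _ & _ & S5 & S6).
  rewrite (Erz _ _ _ _ H) in S5; rewrite (Epz _ _ _ _ H) in S6.
  unfold depends_on_sz; rewrite <- S5, <- S6.
  rewrite (Er _ _ _ _ H), (Ep _ _ _ _ H), (Ers _ _ _ _ H), (Err _ _ _ _ H),
    (Eps _ _ _ _ H), (Epr _ _ _ _ H), (Epp _ _ _ _ H).
  unfold affine_sz; repeat split; ring.
Qed.

Lemma affine_of_second_partials c w F : 0 < c -> 0 < w -> smooth_on (dom c w) F ->
  (forall s r phi z, dom c w s r phi z -> depends_on_sz F s r phi z) ->
  (forall s r phi z, dom c w s r phi z ->
    d_s (d_s F) s r phi z = 0 /\ d_s (d_z F) s r phi z = 0 /\ d_z (d_z F) s r phi z = 0) ->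
  exists a b d, agree (dom c w) F (affine_sz a b d).
Proof.
  intros hc hw HF E0 E2.
  destruct (affine_of_partials c w (d_s F) 0 0 hc hw ltac:(auto with smth)) as [b Hb].
  { intros s r phi z H.
    destruct (smooth_schwarz c w F s r phi z HF H) as (-> & -> & -> & _).
    destruct (E0 _ _ _ _ H) as [_ X]; destruct (E2 _ _ _ _ H) as (? & ? & ?); tauto. }
  destruct (affine_of_partials c w (d_z F) 0 0 hc hw ltac:(auto with smth)) as [d Hd].
  { intros s r phi z H.
    destruct (E0 _ _ _ _ H) as [_ X]; destruct (E2 _ _ _ _ H) as (? & ? & ?); tauto. }
  destruct (affine_of_partials c w F b d hc hw HF) as [a Ha].
  { intros s r phi z H; rewrite (Hb _ _ _ _ H), (Hd _ _ _ _ H).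
    destruct (E0 _ _ _ _ H) as [[? ?] _]; unfold affine_sz; repeat split; lra. }
  now exists a, b, d.
Qed.

Lemma point_symmetry_classification c w G : 0 < c -> 0 < w -> point_symmetry c w G ->
  exists a0 a1 a2 p b0 b1 b2, vf_eq (dom c w) G (sym_field a0 a1 a2 p b0 b1 b2).
Proof.
  intros hc hw HG; pose proof HG as [(HS & HU & HV & HZ) _].
  pose proof (fun s r phi z => determining_z c w G s r phi z HG) as Dz; cbv zeta in Dz.
  pose proof (hessian_zero c w _ hc hw HS ltac:(apply Dz) ltac:(apply Dz) ltac:(apply Dz)) as S0.
  pose proof (hessian_zero c w _ hc hw HZ ltac:(apply Dz) ltac:(apply Dz) ltac:(apply Dz)) as Z0.
  pose proof (depends_on_sz_intro c w _ HS S0) as S1.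
  pose proof (depends_on_sz_intro c w _ HZ Z0) as Z1.
  pose proof (fun s r phi z H => determining_r c w G s r phi z hc hw HG H
    (S1 s r phi z H) (proj2 (proj2 (proj1 (proj1 (Dz s r phi z H)))))) as Dr.
  pose proof (fun s r phi z H => determining_phi c w G s r phi z hc hw HG H
    (S1 s r phi z H) (proj2 (proj2 (proj1 (proj1 (Dz s r phi z H)))))) as Dp.
  cbv zeta in Dr, Dp.
  assert (mixed : forall F, smooth_on (dom c w) F ->
    (forall s r phi z, dom c w s r phi z -> depends_on_sz F s r phi z) ->
    forall s r phi z, dom c w s r phi z ->
      d_r (d_s (d_z F)) s r phi z = 0 /\ d_phi (d_s (d_z F)) s r phi z = 0).
  { intros F HF F1 s r phi z H.
    destruct (smooth_schwarz c w (d_z F) s r phi z ltac:(auto with smth) H)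
      as (-> & -> & _).
    assert (E : forall K, agree (dom c w) K (affine_sz 0 0 0) -> d_s K s r phi z = 0).
    { intros K E; rewrite (agree_d_s _ _ _ _ E _ _ _ _ H); apply d_s_affine_sz. }
    split; apply E; intros s' r' phi' z' H'; destruct (F1 _ _ _ _ H') as [_ X];
      unfold affine_sz; lra. }
  (* The field (R_z, Phi_z) with l = Sigma_sz. *)
  assert (Tz : forall s r phi z, dom c w s r phi z ->
    d_z (cr G) s r phi z = 0 /\ d_z (cphi G) s r phi z = 0 /\ d_s (d_z (cs G)) s r phi z = 0).
  { apply (homothetic_parallel_zero c w); auto with smth;
      intros s r phi z H; destruct (Dr _ _ _ _ H); destruct (Dp _ _ _ _ H);
      first [lra | now apply mixed]. }
  (* The field (R_s, Phi_s) with l = Z_sz; the equations contain l as Sigma_ss / 2. *)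
  assert (Ts : forall s r phi z, dom c w s r phi z ->
    d_s (cr G) s r phi z = 0 /\ d_s (cphi G) s r phi z = 0 /\ d_s (d_z (cz G)) s r phi z = 0).
  { apply (homothetic_parallel_zero c w); auto with smth;
      intros s r phi z H; destruct (Dr _ _ _ _ H); destruct (Dp _ _ _ _ H);
      destruct (Dz _ _ _ _ H) as [_ ?];
      destruct (smooth_schwarz c w (cr G) s r phi z HU H) as (? & ? & _);
      destruct (smooth_schwarz c w (cphi G) s r phi z HV H) as (? & ? & _);
      first [lra | now apply mixed]. }
  assert (T0 : forall s r phi z, dom c w s r phi z ->
    cr G s r phi z = 0 /\ d_r (cphi G) s r phi z = 0 /\ d_phi (cphi G) s r phi z = 0).
  { apply (affine_field_zero c w); auto; intros s r phi z H;
    destruct (Dr _ _ _ _ H); destruct (Dp _ _ _ _ H); lra. }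
  (* Sigma_ss = 2 Z_sz and Z_zz = 2 Sigma_sz, so the vanishing of both l settles all second
     derivatives. *)
  destruct (affine_of_second_partials c w (cs G) hc hw HS S1) as (a0 & a1 & a2 & Ea).
  { intros s r phi z H; destruct (Dz _ _ _ _ H) as [? ?].
    destruct (Ts _ _ _ _ H) as (_ & _ & ?); destruct (Tz _ _ _ _ H) as (_ & _ & ?).
    repeat split; lra. }
  destruct (affine_of_second_partials c w (cz G) hc hw HZ Z1) as (b0 & b1 & b2 & Eb).
  { intros s r phi z H; destruct (Dz _ _ _ _ H) as [? ?].
    destruct (Ts _ _ _ _ H) as (_ & _ & ?); destruct (Tz _ _ _ _ H) as (_ & _ & ?).
    repeat split; lra. }
  destruct (affine_of_partials c w (cphi G) 0 0 hc hw HV) as (p & Ep).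
  { intros s r phi z H; destruct (Ts _ _ _ _ H) as (_ & ? & _).
    destruct (Tz _ _ _ _ H) as (_ & ? & _); destruct (T0 _ _ _ _ H) as (_ & ? & ?); auto. }
  exists a0, a1, a2, p, b0, b1, b2; apply vf_eq_sym_field; repeat split; auto.
  intros s r phi z H; rewrite (proj1 (T0 _ _ _ _ H)); unfold affine_sz; ring.
Qed.

(** * Lie algebra structure *)

Ltac field_eq := intros ? ? ? ? ?; simpl; unfold affine_sz; repeat split; ring.

Lemma vf_eq_sym U G H : vf_eq U G H -> vf_eq U H G.
Proof. intros E s r phi z K; destruct (E s r phi z K) as (? & ? & ? & ?); auto. Qed.

Lemma vf_eq_trans U G H K : vf_eq U G H -> vf_eq U H K -> vf_eq U G K.
Proof.
  intros E1 E2 s r phi z D.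
  destruct (E1 s r phi z D) as (-> & -> & -> & ->); exact (E2 s r phi z D).
Qed.

Lemma add_sym_field U G H a0 a1 a2 p b0 b1 b2 a0' a1' a2' p' b0' b1' b2' :
  vf_eq U G (sym_field a0 a1 a2 p b0 b1 b2) ->
  vf_eq U H (sym_field a0' a1' a2' p' b0' b1' b2') ->
  vf_eq U (vf_add G H) (sym_field (a0 + a0') (a1 + a1') (a2 + a2') (p + p')
    (b0 + b0') (b1 + b1') (b2 + b2')).
Proof.
  intros E1 E2 s r phi z D; simpl.
  destruct (E1 s r phi z D) as (-> & -> & -> & ->).
  destruct (E2 s r phi z D) as (-> & -> & -> & ->).
  simpl; unfold affine_sz; repeat split; ring.
Qed.

Lemma scal_sym_field U k G a0 a1 a2 p b0 b1 b2 :
  vf_eq U G (sym_field a0 a1 a2 p b0 b1 b2) ->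
  vf_eq U (vf_scal k G) (sym_field (k * a0) (k * a1) (k * a2) (k * p)
    (k * b0) (k * b1) (k * b2)).
Proof.
  intros E1 s r phi z D; simpl.
  destruct (E1 s r phi z D) as (-> & -> & -> & ->).
  simpl; unfold affine_sz; repeat split; ring.
Qed.

Lemma zero_sym_field U : vf_eq U vf_zero (sym_field 0 0 0 0 0 0 0).
Proof. field_eq. Qed.

(** This is the commutator of affine fields of the plane; d/dphi is central and contributes
    nothing. *)
Lemma bracket_sym_field c w G H a0 a1 a2 p b0 b1 b2 a0' a1' a2' p' b0' b1' b2' :
  vf_eq (dom c w) G (sym_field a0 a1 a2 p b0 b1 b2) ->
  vf_eq (dom c w) H (sym_field a0' a1' a2' p' b0' b1' b2') ->
  vf_eq (dom c w) (lie_bracket G H)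
    (sym_field (a0 * a1' + b0 * a2' - a0' * a1 - b0' * a2)
       (b1 * a2' - b1' * a2)
       (a2 * a1' + b2 * a2' - a2' * a1 - b2' * a2)
       0
       (a0 * b1' + b0 * b2' - a0' * b1 - b0' * b2)
       (a1 * b1' + b1 * b2' - a1' * b1 - b1' * b2)
       (a2 * b1' - a2' * b1)).
Proof.
  intros EG EH s r phi z D; pose proof EG as EG'; pose proof EH as EH'.
  apply vf_eq_sym_field in EG'; destruct EG' as (Gs & Gr & Gp & Gz).
  apply vf_eq_sym_field in EH'; destruct EH' as (Hs & Hr & Hp & Hz).
  destruct (EG s r phi z D) as (Es & Er & Ep & Ez).
  destruct (EH s r phi z D) as (Fs & Fr & Fp & Fz).
  assert (App : forall K L F a b d a0 a1 a2 p b0 b1 b2, K = sym_field a0 a1 a2 p b0 b1 b2 ->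
    vf_eq (dom c w) L K -> agree (dom c w) F (affine_sz a b d) ->
    vf_app L F s r phi z = cs K s r phi z * b + cz K s r phi z * d).
  { intros K L F a b d ? ? ? ? ? ? ? -> EL EF; destruct (EL s r phi z D) as (X1 & X2 & X3 & X4).
    destruct (agree_d_affine _ _ _ _ _ _ EF) as (As & Ar & Ap & Az).
    unfold vf_app; rewrite X1, X2, X3, X4, (As _ _ _ _ D), (Ar _ _ _ _ D),
      (Ap _ _ _ _ D), (Az _ _ _ _ D); simpl; unfold affine_sz; ring. }
  simpl.
  rewrite (App _ _ _ _ _ _ _ _ _ _ _ _ _ eq_refl EG Hs), (App _ _ _ _ _ _ _ _ _ _ _ _ _ eq_refl EG Hr),
    (App _ _ _ _ _ _ _ _ _ _ _ _ _ eq_refl EG Hp), (App _ _ _ _ _ _ _ _ _ _ _ _ _ eq_refl EG Hz),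
    (App _ _ _ _ _ _ _ _ _ _ _ _ _ eq_refl EH Gs), (App _ _ _ _ _ _ _ _ _ _ _ _ _ eq_refl EH Gr),
    (App _ _ _ _ _ _ _ _ _ _ _ _ _ eq_refl EH Gp), (App _ _ _ _ _ _ _ _ _ _ _ _ _ eq_refl EH Gz).
  simpl; unfold affine_sz; repeat split; ring.
Qed.

Lemma sym_field_zero_inv c w a0 a1 a2 p b0 b1 b2 : 0 < c -> 0 < w ->
  vf_eq (dom c w) (sym_field a0 a1 a2 p b0 b1 b2) vf_zero ->
  (a0 = 0 /\ a1 = 0 /\ a2 = 0 /\ p = 0) /\ b0 = 0 /\ b1 = 0 /\ b2 = 0.
Proof.
  intros hc hw E.
  assert (D : forall s z, dom c w s (c / w / 2) 0 z).
  { intros s z; assert (0 < c / w) by now apply Rdiv_lt_0_compat.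
    unfold dom; lra. }
  destruct (E _ _ _ _ (D 0 0)) as (E1 & _ & E2 & E3).
  destruct (E _ _ _ _ (D 1 0)) as (E4 & _ & _ & E5).
  destruct (E _ _ _ _ (D 0 1)) as (E6 & _ & _ & E7).
  simpl in *; unfold affine_sz in *; lra.
Qed.

Lemma point_symmetry_iff c w G : 0 < c -> 0 < w -> point_symmetry c w G <->
  exists a0 a1 a2 p b0 b1 b2, vf_eq (dom c w) G (sym_field a0 a1 a2 p b0 b1 b2).
Proof.
  intros hc hw; split; [now apply point_symmetry_classification |].
  intros (a0 & a1 & a2 & p & b0 & b1 & b2 & E); now apply point_symmetry_sym_field in E.
Qed.

(** * Variation of the arclength *)

(** The terms in Sigma cancel by Euler's identity for a function homogeneous of degree one in the
    velocities, and d/dphi is an isometry; only the change of z' remains. *)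
Lemma arclength_variation c w G a0 a1 a2 p b0 b1 b2 s r phi z r1 phi1 z1 :
  0 < c -> 0 < w -> vf_eq (dom c w) G (sym_field a0 a1 a2 p b0 b1 b2) ->
  dom c w s r phi z -> (r1, phi1, z1) <> (0, 0, 0) ->
  0 < arclength c w s r phi z r1 phi1 z1 /\
  pr1 G (arclength c w) s r phi z r1 phi1 z1
  + arclength c w s r phi z r1 phi1 z1 * dot (cs G) s r phi z r1 phi1 z1
  = (b1 + b2 * z1) * z1 / arclength c w s r phi z r1 phi1 z1.
Proof.
  intros hc hw E H Hv; destruct (dom_pos _ _ _ _ _ _ hc hw H) as [hr hD].
  apply vf_eq_sym_field in E; destruct E as (Es & Er & Ep & Ez).
  unfold pr1, arclength.
  rewrite (dot_affine _ _ _ _ _ _ _ _ _ _ _ _ _ Es H),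
    (dot_affine _ _ _ _ _ _ _ _ _ _ _ _ _ Er H),
    (dot_affine _ _ _ _ _ _ _ _ _ _ _ _ _ Ep H),
    (dot_affine _ _ _ _ _ _ _ _ _ _ _ _ _ Ez H), (Er _ _ _ _ H), !Derive_const.
  assert (hB : 0 < c ^ 2 * r ^ 2 / (c ^ 2 - w ^ 2 * r ^ 2)).
  { apply Rdiv_lt_0_compat; [| exact hD]; apply Rmult_lt_0_compat; now apply pow_lt. }
  replace (affine_sz 0 0 0 s r phi z) with 0 by (unfold affine_sz; ring); rewrite Rmult_0_l.
  set (B := c ^ 2 * r ^ 2 / (c ^ 2 - w ^ 2 * r ^ 2)) in *.
  assert (hN : 0 < r1 ^ 2 + B * phi1 ^ 2 + z1 ^ 2).
  { pose proof (pow2_ge_0 r1); pose proof (pow2_ge_0 z1).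
    assert (0 <= B * phi1 ^ 2) by (apply Rmult_le_pos; [lra | apply pow2_ge_0]).
    destruct (Req_dec r1 0) as [-> | N1]; [| pose proof (pow2_gt_0 _ N1); lra].
    destruct (Req_dec z1 0) as [-> | N2]; [| pose proof (pow2_gt_0 _ N2); lra].
    destruct (Req_dec phi1 0) as [-> | N3]; [now contradict Hv |].
    pose proof (Rmult_lt_0_compat _ _ hB (pow2_gt_0 _ N3)); lra. }
  pose proof (sqrt_lt_R0 _ hN) as hL.
  set (L := sqrt (r1 ^ 2 + B * phi1 ^ 2 + z1 ^ 2)) in *.
  assert (hL2 : L * L = r1 ^ 2 + B * phi1 ^ 2 + z1 ^ 2) by (apply sqrt_sqrt; lra).
  split; [exact hL |].
  rewrite (Derive_value (fun t => sqrt (t ^ 2 + B * phi1 ^ 2 + z1 ^ 2)) r1 (r1 / L)),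
    (Derive_value (fun t => sqrt (r1 ^ 2 + B * t ^ 2 + z1 ^ 2)) phi1 (B * phi1 / L)),
    (Derive_value (fun t => sqrt (r1 ^ 2 + B * phi1 ^ 2 + t ^ 2)) z1 (z1 / L)).
  2-4: auto_derive; [exact hN |];
    match goal with |- context [sqrt ?x] =>
      replace (sqrt x) with L by (unfold L; f_equal; ring) end; field; lra.
  apply (Rmult_eq_reg_r L); [| lra].
  transitivity ((b1 + b2 * z1) * z1 + (a1 + a2 * z1) * (L * L - (r1 ^ 2 + B * phi1 ^ 2 + z1 ^ 2))).
  - field; lra.
  - rewrite hL2; field; lra.
Qed.

Lemma variational_point_symmetry_iff c w G : 0 < c -> 0 < w ->
  variational_point_symmetry c w G <->
  exists a0 a1 a2 p b0, vf_eq (dom c w) G (sym_field a0 a1 a2 p b0 0 0).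
Proof.
  intros hc hw; split.
  - intros [HG [_ HV]].
    apply point_symmetry_iff in HG; [| assumption | assumption].
    destruct HG as (a0 & a1 & a2 & p & b0 & b1 & b2 & E).
    assert (D : dom c w 0 (c / w / 2) 0 0).
    { assert (0 < c / w) by now apply Rdiv_lt_0_compat. unfold dom; lra. }
    (* Velocities along the z-axis suffice: the two directions z' = 1 and z' = -1 separate b1 from
       b2. *)
    assert (K : forall z1, z1 <> 0 -> b1 + b2 * z1 = 0).
    { intros z1 Hz; assert (Hv : (0, 0, z1) <> (0, 0, 0)) by congruence.
      destruct (arclength_variation _ _ _ _ _ _ _ _ _ _ _ _ _ _ _ _ _ hc hw E D Hv) as [hL X].
      rewrite (HV _ _ _ _ _ _ _ D Hv) in X.
      apply (Rmult_eq_0_reg (z1 / arclength c w 0 (c / w / 2) 0 0 0 0 z1)).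
      - apply Rmult_integral_contrapositive_currified; [exact Hz |].
        apply Rinv_neq_0_compat; lra.
      - transitivity ((b1 + b2 * z1) * z1 / arclength c w 0 (c / w / 2) 0 0 0 0 z1);
          [unfold Rdiv; ring | now symmetry]. }
    pose proof (K 1 ltac:(lra)); pose proof (K (-1) ltac:(lra)).
    assert (b1 = 0) by lra; assert (b2 = 0) by lra; subst.
    now exists a0, a1, a2, p, b0.
  - intros (a0 & a1 & a2 & p & b0 & E).
    assert (HG : point_symmetry c w G) by now apply point_symmetry_sym_field in E.
    split; [exact HG | split; [apply HG |]].
    intros s r phi z r1 phi1 z1 D Hv.
    destruct (arclength_variation _ _ _ _ _ _ _ _ _ _ _ _ _ _ _ _ _ hc hw E D Hv) as [hL ->].
    field; lra.
Qed.

(** * Closure and dimension of the two algebras *)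

Lemma point_symmetry_lie_algebra c w : 0 < c -> 0 < w ->
  is_lie_algebra (dom c w) (point_symmetry c w).
Proof.
  intros hc hw; split; [intros G HG; apply HG |].
  split; [| split; [| split; [| split]]]; intros;
    repeat match goal with
    | K : point_symmetry _ _ _ |- _ => apply point_symmetry_iff in K; [| assumption ..];
        destruct K as (? & ? & ? & ? & ? & ? & ? & ?)
    end; apply point_symmetry_iff; try assumption; do 7 eexists.
  - eapply vf_eq_trans; [apply vf_eq_sym |]; eassumption.
  - apply zero_sym_field.
  - eapply add_sym_field; eassumption.
  - eapply scal_sym_field; eassumption.
  - eapply bracket_sym_field; eassumption.
Qed.

Lemma variational_lie_algebra c w : 0 < c -> 0 < w ->
  is_lie_algebra (dom c w) (variational_point_symmetry c w).
Proof.
  intros hc hw; split; [intros G HG; apply HG |].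
  split; [| split; [| split; [| split]]].
  - intros G H E HG; apply variational_point_symmetry_iff in HG; try assumption.
    apply variational_point_symmetry_iff; try assumption.
    destruct HG as (a0 & a1 & a2 & p & b0 & EG); exists a0, a1, a2, p, b0.
    eapply vf_eq_trans; [apply vf_eq_sym |]; eassumption.
  - apply variational_point_symmetry_iff; try assumption.
    exists 0, 0, 0, 0, 0; apply zero_sym_field.
  - intros G H HG HH; apply variational_point_symmetry_iff in HG, HH; try assumption.
    apply variational_point_symmetry_iff; try assumption.
    destruct HG as (a0 & a1 & a2 & p & b0 & EG).
    destruct HH as (a0' & a1' & a2' & p' & b0' & EH).
    exists (a0 + a0'), (a1 + a1'), (a2 + a2'), (p + p'), (b0 + b0').
    eapply vf_eq_trans; [eapply add_sym_field; eassumption | field_eq].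
  - intros k G HG; apply variational_point_symmetry_iff in HG; try assumption.
    apply variational_point_symmetry_iff; try assumption.
    destruct HG as (a0 & a1 & a2 & p & b0 & EG).
    exists (k * a0), (k * a1), (k * a2), (k * p), (k * b0).
    eapply vf_eq_trans; [eapply scal_sym_field; eassumption | field_eq].
  - intros G H HG HH; apply variational_point_symmetry_iff in HG, HH; try assumption.
    apply variational_point_symmetry_iff; try assumption.
    destruct HG as (a0 & a1 & a2 & p & b0 & EG).
    destruct HH as (a0' & a1' & a2' & p' & b0' & EH).
    exists (a0 * a1' + b0 * a2' - a0' * a1 - b0' * a2), 0, (a2 * a1' - a2' * a1), 0, 0.
    eapply vf_eq_trans; [eapply bracket_sym_field; eassumption | field_eq].
Qed.

Lemma vf_eq_refl U G : vf_eq U G G.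
Proof. intros s r phi z _; auto. Qed.

Lemma point_symmetry_dim c w : 0 < c -> 0 < w -> has_dim (dom c w) (point_symmetry c w) 7.
Proof.
  intros hc hw.
  exists (fun i => match i with
    | 0%nat => sym_field 1 0 0 0 0 0 0 | 1%nat => sym_field 0 1 0 0 0 0 0
    | 2%nat => sym_field 0 0 1 0 0 0 0 | 3%nat => sym_field 0 0 0 1 0 0 0
    | 4%nat => sym_field 0 0 0 0 1 0 0 | 5%nat => sym_field 0 0 0 0 0 1 0
    | _ => sym_field 0 0 0 0 0 0 1 end).
  split; [| split].
  - intros i _; apply point_symmetry_iff; try assumption.
    do 6 (destruct i as [|i]; [do 7 eexists; apply vf_eq_refl |]).
    do 7 eexists; apply vf_eq_refl.
  - intros a E.
    assert (K : (a 0%nat = 0 /\ a 1%nat = 0 /\ a 2%nat = 0 /\ a 3%nat = 0) /\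
      a 4%nat = 0 /\ a 5%nat = 0 /\ a 6%nat = 0).
    { apply (sym_field_zero_inv c w); try assumption.
      apply vf_eq_trans with (2 := E); field_eq. }
    intros i Hi; do 7 (destruct i as [|i]; [tauto |]); lia.
  - intros G HG; apply point_symmetry_iff in HG; try assumption.
    destruct HG as (a0 & a1 & a2 & p & b0 & b1 & b2 & E).
    exists (fun i => match i with
      | 0%nat => a0 | 1%nat => a1 | 2%nat => a2 | 3%nat => p
      | 4%nat => b0 | 5%nat => b1 | _ => b2 end).
    apply vf_eq_trans with (1 := E); field_eq.
Qed.

Lemma variational_dim c w : 0 < c -> 0 < w ->
  has_dim (dom c w) (variational_point_symmetry c w) 5.
Proof.
  intros hc hw.
  exists (fun i => match i with
    | 0%nat => sym_field 1 0 0 0 0 0 0 | 1%nat => sym_field 0 1 0 0 0 0 0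
    | 2%nat => sym_field 0 0 1 0 0 0 0 | 3%nat => sym_field 0 0 0 1 0 0 0
    | _ => sym_field 0 0 0 0 1 0 0 end).
  split; [| split].
  - intros i _; apply variational_point_symmetry_iff; try assumption.
    do 4 (destruct i as [|i]; [do 5 eexists; apply vf_eq_refl |]).
    do 5 eexists; apply vf_eq_refl.
  - intros a E.
    (* The two trivial equations stand for b1 and b2, which are zero here, and match the form of
       [sym_field_zero_inv]. *)
    assert (K : (a 0%nat = 0 /\ a 1%nat = 0 /\ a 2%nat = 0 /\ a 3%nat = 0) /\
      a 4%nat = 0 /\ 0 = 0 /\ 0 = 0).
    { apply (sym_field_zero_inv c w); try assumption.
      apply vf_eq_trans with (2 := E); field_eq. }
    intros i Hi; do 5 (destruct i as [|i]; [tauto |]); lia.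
  - intros G HG; apply variational_point_symmetry_iff in HG; try assumption.
    destruct HG as (a0 & a1 & a2 & p & b0 & E).
    exists (fun i => match i with
      | 0%nat => a0 | 1%nat => a1 | 2%nat => a2 | 3%nat => p | _ => b0 end).
    apply vf_eq_trans with (1 := E); field_eq.
Qed.

(** * Solvability and nilpotency *)

(** The traceless linear fields a (s d/ds - z d/dz) + e z d/ds + f s d/dz of the (s, z)-plane. *)
Definition sl2_field (a e f : R) : vfield := sym_field 0 a e 0 0 f (- a).

(** This is the perfectness of sl(2). Keeping [g] and [h] apart lets it serve both the derived and
    the lower central series. *)
Lemma sl2_bracket_span c w (g h : vfield -> Prop) :
  (forall a e f, g (sl2_field a e f)) -> (forall a e f, h (sl2_field a e f)) ->
  forall a e f, bracket_span (dom c w) g h (sl2_field a e f).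
Proof.
  intros Hg Hh a e f.
  (* With H = s d/ds - z d/dz, E = z d/ds and F = s d/dz one has [F, E] = H, [H, E] = - 2 E and
     [H, F] = 2 F. *)
  apply bs_eq with (vf_add (lie_bracket (sl2_field 0 0 1) (sl2_field 0 a 0))
    (lie_bracket (sl2_field (1 / 2) 0 0) (sl2_field 0 (- e) f))).
  - eapply vf_eq_trans.
    { eapply add_sym_field; eapply bracket_sym_field; apply vf_eq_refl. }
    intros s r phi z _; simpl; unfold affine_sz; repeat split; field.
  - apply bs_add; apply bs_bracket; auto.
Qed.

Lemma sl2_field_point_symmetry c w a e f : 0 < c -> 0 < w ->
  point_symmetry c w (sl2_field a e f).
Proof. intros hc hw; apply point_symmetry_iff; auto; do 7 eexists; apply vf_eq_refl. Qed.

Lemma sl2_field_neq_0 c w : 0 < c -> 0 < w -> ~ vf_eq (dom c w) (sl2_field 1 0 0) vf_zero.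
Proof. intros hc hw E; apply sym_field_zero_inv in E; lra. Qed.

Lemma point_symmetry_not_nilpotent c w : 0 < c -> 0 < w ->
  ~ nilpotent (dom c w) (point_symmetry c w).
Proof.
  intros hc hw [n Hn]; apply (sl2_field_neq_0 c w hc hw), Hn.
  enough (K : forall a e f,
    lower_central_series (dom c w) (point_symmetry c w) n (sl2_field a e f)) by apply K.
  clear Hn; induction n as [|n IH]; simpl.
  - intros; now apply sl2_field_point_symmetry.
  - apply sl2_bracket_span; [intros; now apply sl2_field_point_symmetry | exact IH].
Qed.

Lemma point_symmetry_not_solvable c w : 0 < c -> 0 < w ->
  ~ solvable (dom c w) (point_symmetry c w).
Proof.
  intros hc hw [n Hn]; apply (sl2_field_neq_0 c w hc hw), Hn.
  enough (K : forall a e f,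
    derived_series (dom c w) (point_symmetry c w) n (sl2_field a e f)) by apply K.
  clear Hn; induction n as [|n IH]; simpl.
  - intros; now apply sl2_field_point_symmetry.
  - now apply sl2_bracket_span.
Qed.

Lemma variational_not_nilpotent c w : 0 < c -> 0 < w ->
  ~ nilpotent (dom c w) (variational_point_symmetry c w).
Proof.
  intros hc hw [n Hn].
  assert (K : lower_central_series (dom c w) (variational_point_symmetry c w) n
    (sym_field 1 0 0 0 0 0 0)).
  { clear Hn; induction n as [|n IH]; simpl.
    - apply variational_point_symmetry_iff; auto; do 5 eexists; apply vf_eq_refl.
    (* [- s d/ds, d/ds] = d/ds, so d/ds survives in every term of the series. *)
    - apply bs_eq with (lie_bracket (sym_field 0 (- 1) 0 0 0 0 0) (sym_field 1 0 0 0 0 0 0)).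
      + eapply vf_eq_trans; [eapply bracket_sym_field; apply vf_eq_refl | field_eq].
      + apply bs_bracket; [| exact IH].
        apply variational_point_symmetry_iff; auto; do 5 eexists; apply vf_eq_refl. }
  apply Hn, sym_field_zero_inv in K; lra.
Qed.

(** Brackets of variational symmetries lie in the span of d/ds and z d/ds, because s d/ds rescales
    these two and d/dz maps z d/ds to d/ds. *)
Lemma variational_derived c w G : 0 < c -> 0 < w ->
  derived_series (dom c w) (variational_point_symmetry c w) 1 G ->
  exists a0 a2, vf_eq (dom c w) G (sym_field a0 0 a2 0 0 0 0).
Proof.
  intros hc hw HG; simpl in HG; induction HG as
    [G H HG HH | | G H _ (a0 & a2 & EG) _ (a0' & a2' & EH) | k G _ (a0 & a2 & EG)
    | G H E _ (a0 & a2 & EG)].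
  - apply variational_point_symmetry_iff in HG, HH; try assumption.
    destruct HG as (a0 & a1 & a2 & p & b0 & EG).
    destruct HH as (a0' & a1' & a2' & p' & b0' & EH).
    exists (a0 * a1' + b0 * a2' - a0' * a1 - b0' * a2), (a2 * a1' - a2' * a1).
    eapply vf_eq_trans; [eapply bracket_sym_field; eassumption | field_eq].
  - exists 0, 0; apply zero_sym_field.
  - exists (a0 + a0'), (a2 + a2').
    eapply vf_eq_trans; [eapply add_sym_field; eassumption | field_eq].
  - exists (k * a0), (k * a2).
    eapply vf_eq_trans; [eapply scal_sym_field; eassumption | field_eq].
  - exists a0, a2; eapply vf_eq_trans; [apply vf_eq_sym |]; eassumption.
Qed.

(** The fields d/ds and z d/ds commute, so the second derived algebra is zero. *)
Lemma variational_solvable c w : 0 < c -> 0 < w ->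
  solvable (dom c w) (variational_point_symmetry c w).
Proof.
  intros hc hw; exists 2%nat; intros G HG.
  change (bracket_span (dom c w)
    (derived_series (dom c w) (variational_point_symmetry c w) 1)
    (derived_series (dom c w) (variational_point_symmetry c w) 1) G) in HG.
  apply vf_eq_trans with (2 := vf_eq_sym _ _ _ (zero_sym_field _)).
  induction HG as [G H HG HH | | G H _ EG _ EH | k G _ EG | G H E _ EG].
  - apply variational_derived in HG, HH; try assumption.
    destruct HG as (a0 & a2 & EG); destruct HH as (a0' & a2' & EH).
    eapply vf_eq_trans; [eapply bracket_sym_field; eassumption | field_eq].
  - apply zero_sym_field.
  - eapply vf_eq_trans; [eapply add_sym_field; eassumption | field_eq].
  - eapply vf_eq_trans; [eapply scal_sym_field; eassumption | field_eq].
  - eapply vf_eq_trans; [apply vf_eq_sym |]; eassumption.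
Qed.

(** * The metric, its geodesic equations and its arclength *)

(** The phi phi component f^2 of the metric; A = f f' is half its derivative. *)
Definition cB c w r := r ^ 2 / (1 - w ^ 2 * r ^ 2 / c ^ 2).

Lemma cB_eq c w r : 0 < c -> 0 < c ^ 2 - w ^ 2 * r ^ 2 ->
  cB c w r = c ^ 2 * r ^ 2 / (c ^ 2 - w ^ 2 * r ^ 2).
Proof. intros hc hD; unfold cB; field; split; lra. Qed.

Lemma is_derive_cB c w r : 0 < c -> 0 < c ^ 2 - w ^ 2 * r ^ 2 ->
  is_derive (cB c w) r (2 * cA c w r).
Proof.
  intros hc hD; unfold cB, cA.
  assert (hE : 1 - w ^ 2 * r ^ 2 / c ^ 2 <> 0).
  { replace (1 - w ^ 2 * r ^ 2 / c ^ 2) with ((c ^ 2 - w ^ 2 * r ^ 2) / c ^ 2) by (field; lra).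
    apply Rgt_not_eq, Rdiv_lt_0_compat; [exact hD | now apply pow_lt]. }
  auto_derive; [exact hE | field; repeat split; lra].
Qed.

(** In an Euler-Lagrange expression the velocity derivative of the Lagrangian is differentiated once
    more, so it must be rewritten as a function and not at one point. *)
Lemma fn1_ext (F K : fn1) :
  (forall s r phi z r1 phi1 z1, F s r phi z r1 phi1 z1 = K s r phi z r1 phi1 z1) -> F = K.
Proof. intros E; do 7 (apply functional_extensionality; intro); apply E. Qed.

(** The Euler-Lagrange expressions of the energy are the geodesic equations with lowered index,
    hence the factor [cB] in the phi equation. *)
Lemma Euler_Lagrange_energy c w s r phi z r1 phi1 z1 r2 phi2 z2 :
  0 < c -> 0 < w -> dom c w s r phi z ->
  EL_r (energy c w) s r phi z r1 phi1 z1 r2 phi2 z2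
    = geo_r c w s r phi z r1 phi1 z1 r2 phi2 z2 /\
  EL_phi (energy c w) s r phi z r1 phi1 z1 r2 phi2 z2
    = cB c w r * geo_phi c w s r phi z r1 phi1 z1 r2 phi2 z2 /\
  EL_z (energy c w) s r phi z r1 phi1 z1 r2 phi2 z2
    = geo_z c w s r phi z r1 phi1 z1 r2 phi2 z2.
Proof.
  intros hc hw H; destruct (dom_pos _ _ _ _ _ _ hc hw H) as [hr hD].
  pose proof (is_derive_cB c w r hc hD) as DB.
  assert (Lr1 : (fun s r phi z r1 phi1 z1 =>
    Derive (fun t => energy c w s r phi z t phi1 z1) r1) = (fun _ _ _ _ r1 _ _ => r1)).
  { apply fn1_ext; intros; apply Derive_value; unfold energy, metric; fold (cB c w r0).
    auto_derive; [exact I | field]. }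
  assert (Lp1 : (fun s r phi z r1 phi1 z1 =>
    Derive (fun t => energy c w s r phi z r1 t z1) phi1)
    = (fun _ r _ _ _ phi1 _ => cB c w r * phi1)).
  { apply fn1_ext; intros; apply Derive_value; unfold energy, metric; fold (cB c w r0).
    auto_derive; [exact I | field]. }
  assert (Lz1 : (fun s r phi z r1 phi1 z1 =>
    Derive (fun t => energy c w s r phi z r1 phi1 t) z1) = (fun _ _ _ _ _ _ z1 => z1)).
  { apply fn1_ext; intros; apply Derive_value; unfold energy, metric; fold (cB c w r0).
    auto_derive; [exact I | field]. }
  assert (Lr : Derive (fun t => energy c w s t phi z r1 phi1 z1) r = cA c w r * phi1 ^ 2).
  { apply Derive_value; unfold energy, metric.
    change (is_derive (fun t => (r1 ^ 2 + cB c w t * phi1 ^ 2 + z1 ^ 2) * / 2) r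
      (cA c w r * phi1 ^ 2)).
    derive; field. }
  assert (Br : Derive (fun t => cB c w t * phi1) r = 2 * cA c w r * phi1)
    by (apply Derive_value; derive).
  assert (Bp : Derive (fun t => cB c w r * t) phi1 = cB c w r)
    by (apply Derive_value; derive).
  unfold EL_r, EL_phi, EL_z; rewrite Lr1, Lp1, Lz1, Lr; unfold total1.
  rewrite !Derive_const, !Derive_id, Br, Bp; unfold energy, metric; rewrite !Derive_const.
  unfold geo_r, geo_phi, geo_z; rewrite cB_eq by assumption; unfold cA.
  repeat split; field; lra.
Qed.

Lemma metric_geodesic_iff c w s r phi z r1 phi1 z1 r2 phi2 z2 :
  0 < c -> 0 < w -> dom c w s r phi z ->
  metric_geodesic c w s r phi z r1 phi1 z1 r2 phi2 z2 <->
  geodesic_system c w s r phi z r1 phi1 z1 r2 phi2 z2.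
Proof.
  intros hc hw H; destruct (dom_pos _ _ _ _ _ _ hc hw H) as [hr hD].
  unfold metric_geodesic, geodesic_system.
  destruct (Euler_Lagrange_energy c w s r phi z r1 phi1 z1 r2 phi2 z2 hc hw H)
    as (-> & -> & ->).
  split; intros (E1 & E2 & E3); repeat split; try assumption.
  - apply (Rmult_eq_0_reg (cB c w r)); [| exact E2].
    rewrite cB_eq by assumption; apply Rgt_not_eq, Rdiv_lt_0_compat; [| exact hD].
    apply Rmult_lt_0_compat; now apply pow_lt.
  - rewrite E2; ring.
Qed.

Lemma arclength_metric c w s r phi z r1 phi1 z1 : 0 < c -> 0 < w -> dom c w s r phi z ->
  arclength c w s r phi z r1 phi1 z1 = sqrt (metric c w r phi z r1 phi1 z1).
Proof.
  intros hc hw H; destruct (dom_pos _ _ _ _ _ _ hc hw H) as [hr hD].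
  unfold arclength, metric; fold (cB c w r); now rewrite cB_eq.
Qed.

Theorem theorem1 (c w : R) (hc : 0 < c) (hw : 0 < w) :
  (forall s r phi z r1 phi1 z1 r2 phi2 z2 : R, dom c w s r phi z ->
     (metric_geodesic c w s r phi z r1 phi1 z1 r2 phi2 z2 <->
      geodesic_system c w s r phi z r1 phi1 z1 r2 phi2 z2)) /\
  (forall s r phi z r1 phi1 z1 : R, dom c w s r phi z ->
     arclength c w s r phi z r1 phi1 z1 =
     sqrt (metric c w r phi z r1 phi1 z1)) /\
  is_lie_algebra (dom c w) (point_symmetry c w) /\
  has_dim (dom c w) (point_symmetry c w) 7 /\
  ~ nilpotent (dom c w) (point_symmetry c w) /\
  ~ solvable (dom c w) (point_symmetry c w) /\
  is_lie_algebra (dom c w) (variational_point_symmetry c w) /\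
  has_dim (dom c w) (variational_point_symmetry c w) 5 /\
  solvable (dom c w) (variational_point_symmetry c w) /\
  ~ nilpotent (dom c w) (variational_point_symmetry c w).
Proof.
  split; [intros; now apply metric_geodesic_iff |].
  split; [intros; now apply arclength_metric |].
  split; [now apply point_symmetry_lie_algebra |].
  split; [now apply point_symmetry_dim |].
  split; [now apply point_symmetry_not_nilpotent |].
  split; [now apply point_symmetry_not_solvable |].
  split; [now apply variational_lie_algebra |].
  split; [now apply variational_dim |].
  split; [now apply variational_solvable | now apply variational_not_nilpotent].
Qed.
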